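(* Let $\mathbb{F}$ be a field and let $R(s)\in\mathbb{F}(s)^{m\times n}$ be a rational matrix (respectively, let $R(s)\in\mathbb{F}[s]^{m\times n}$ be a polynomial matrix) with $\operatorname{rank}(R(s))=r\ge1$. Let $\mathbf{c}=(c_1,\dots,c_{n-r})$ be its column minimal indices and $\mathbf{u}=(u_1,\dots,u_{m-r})$ its row minimal indices. Let $z,x$ be integers such that $0\le x\le\min\{z,n-r\}$ and let $\mathbf{d}=(d_1,\dots,d_{n-r-x})$ and $\mathbf{v}=(v_1,\dots,v_{m+z-r-x})$ be two partitions. Let $h_x=\min\{i:d_{i-x+1}<c_i\}$. There exists a rational matrix $\widetilde W(s)\in\mathbb{F}(s)^{z\times n}$ (respectively, a polynomial matrix $\widetilde W(s)\in\mathbb{F}[s]^{z\times n}$) such that $\operatorname{rank}\begin{bmatrix}R(s)\\\widetilde W(s)\end{bmatrix}=r+x$ and $\begin{bmatrix}R(s)\\\widetilde W(s)\end{bmatrix}$ has $\mathbf{d}$ as column minimal indices and $\mathbf{v}$ as row minimal indices if and only if all of the following hold: $$d_i=c_{i+x},\quad h_x-x+1\le i\le n-r-x,$$ $$\sum_{i=1}^{m+z-r-x}v_i-\sum_{i=1}^{m-r}u_i\ge0,$$ $$\mathbf{v}\prec'(\mathbf{u},\hat{\tilde{\mathbf{b}}}''),$$ where $\hat{\tilde{\mathbf{b}}}''=(\hat{\tilde b}''_1,\dots,\hat{\tilde b}''_{z-x})$ is defined by $$\sum_{i=1}^{j}\hat{\tilde b}''_i=\sum_{i=1}^{m+z-r-x}v_i-\sum_{i=1}^{m-r}u_i,\quad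 1\le j\le z-x$$ (i.e., $\hat{\tilde b}''_1=\sum_{i=1}^{m+z-r-x}v_i-\sum_{i=1}^{m-r}u_i$ and $\hat{\tilde b}''_i=0$ for $2\le i\le z-x$).
   Context: Structural data. $\mathbb{F}(s)$ is the field of rational functions over $\mathbb{F}$. The rank of a matrix is its rank over $\mathbb{F}(s)$. For a subspace of $\mathbb{F}(s)^{k\times 1}$, a minimal basis is a basis of polynomial vectors whose sum of degrees is least among all polynomial bases; the degrees of its vectors (independent of the choice) are the minimal indices of the subspace. The column (row) minimal indices of $R(s)\in\mathbb{F}(s)^{m\times n}$ are the minimal indices of $\{y\in\mathbb{F}(s)^{n\times1}:R y=0\}$ (of $\{y\in\mathbb{F}(s)^{m\times1}:y^TR=0\}$), always listed in decreasing order; there are $n-r$ column and $m-r$ row minimal indices if $R$ has rank $r$. Conventions. ''Decreasing'' is meant in the weak sense. A partition is a decreasing sequence of nonnegative integers (possibly empty). A decreasing sequence $a_1\ge\dots\ge a_k$ is extended by $a_i=+\infty$ for $i<1$ and $a_i=-\infty$ for $i>k$. (So if $x=0$ then $h_0=0$.) A sum whose upper limit is smaller than its lower limit is $0$; a condition over an empty index range is trivially satisfied. Generalized majorization. Let $\mathbf d=(d_1,\dots,d_k)$, $\mathbf a=(a_1,\dots,a_t)$, $\mathbf g=(g_1,\dots,g_{k+t})$ be sequences of integers ($\mathbf d$, $\mathbf g$ decreasing). Then $\mathbf g\prec'(\mathbf d,\mathbf a)$ means: (i) $d_i\ge g_{i+t}$ for $1\le i\le k$; (ii) $\sum_{i=1}^{h_j}g_i-\sum_{i=1}^{h_j-j}d_i\le\sum_{i=1}^{j}a_i$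 for $1\le j\le t$, where $h_j=\min\{i: d_{i-j+1}<g_i\}$ (with $d_{k+1}=-\infty$); (iii) $\sum_{i=1}^{k+t}g_i=\sum_{i=1}^{k}d_i+\sum_{i=1}^{t}a_i$. If $t=0$ this means $\mathbf g=\mathbf d$. *)

(* Defs.v *)
From HB Require Import structures.
From mathcomp Require Import all_boot all_order all_algebra.
From mathcomp Require Import fraction constructive_ereal.

Set Implicit Arguments.
Unset Strict Implicit.
Unset Printing Implicit Defensive.

Import Order.TTheory GRing.Theory Num.Theory.
Local Open Scope ring_scope.

Notation ratfun F := {fraction {poly F}}.

Section MinimalIndices.
Variable F : fieldType.

Definition ratmx m n (A : 'M[{poly F}]_(m, n)) : 'M[ratfun F]_(m, n) :=
  map_mx (@tofrac {poly F}) A.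

(* The zero vector gets degree 0; it never occurs in a basis. *)
Definition vdeg k (v : 'cV[{poly F}]_k) : nat :=
  (\max_(i < k) size (v i ord0)).-1.

Definition poly_basis k (U : {vspace 'cV[ratfun F]_k})
    (b : seq 'cV[{poly F}]_k) : bool :=
  basis_of U [seq ratmx v | v <- b].

Definition minimal_basis k (U : {vspace 'cV[ratfun F]_k})
    (b : seq 'cV[{poly F}]_k) : Prop :=
  poly_basis U b /\
  forall b', poly_basis U b' ->
    (\sum_(v <- b) vdeg v <= \sum_(v <- b') vdeg v)%N.

(* A relation, functional in [ind] because the degrees do not depend on the
   minimal basis. *)
Definition minimal_indices k (U : {vspace 'cV[ratfun F]_k}) (ind : seq nat)
    : Prop :=
  exists2 b, minimal_basis U b & ind = sort geq [seq vdeg v | v <- b].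

Definition right_kernel m n (R : 'M[ratfun F]_(m, n)) :
    {vspace 'cV[ratfun F]_n} :=
  lker (linfun (mulmx R)).

Definition left_kernel m n (R : 'M[ratfun F]_(m, n)) :
    {vspace 'cV[ratfun F]_m} :=
  lker (linfun (mulmxr R \o trmx)).

Lemma mem_right_kernel m n (R : 'M[ratfun F]_(m, n)) (y : 'cV_n) :
  (y \in right_kernel R) = (R *m y == 0).
Proof. by rewrite memv_ker lfunE. Qed.

Lemma mem_left_kernel m n (R : 'M[ratfun F]_(m, n)) (y : 'cV_m) :
  (y \in left_kernel R) = (y^T *m R == 0).
Proof. by rewrite memv_ker lfunE. Qed.

Definition column_minimal_indices m n (R : 'M[ratfun F]_(m, n)) :=
  minimal_indices (right_kernel R).

Definition row_minimal_indices m n (R : 'M[ratfun F]_(m, n)) :=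
  minimal_indices (left_kernel R).

End MinimalIndices.

Definition zseq (p : seq nat) : seq int := [seq i%:Z | i <- p].

(* The i-th term of the sequence, counted from 1, extended by +oo on the left
   and by -oo on the right. *)
Definition ext (a : seq int) (i : int) : \bar int :=
  if i < 1 then +oo%E
  else if i <= (size a)%:Z then (nth 0 a `|i - 1|)%:E
  else -oo%E.

(* h = min {i : d_(i-j+1) < g_i}, the minimum being over all integers i; it is
   nonnegative by exists_hindex. *)
Definition hindex (d g : seq int) (j h : nat) : Prop :=
  (ext d (h%:Z - j%:Z + 1) < ext g h%:Z)%E /\
  forall i : int, (ext d (i - j%:Z + 1) < ext g i)%E -> h%:Z <= i.

Lemma exists_hindex (d g : seq int) (j : nat) :
  (size d + j <= size g)%N -> exists h, hindex d g j h.
Proof.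
move=> le_dg.
pose P h := (ext d (h%:Z - j%:Z + 1) < ext g h%:Z)%E.
have Pmax : P (size d + j)%N.
  rewrite /P PoszD addrK /ext -PoszD.
  have -> : ((size d)%:Z + 1 < 1) = false by rewrite gtrDr.
  have -> : ((size d)%:Z + 1 <= (size d)%:Z) = false by rewrite gerDl.
  case: ifP => _; first by rewrite ltNye.
  by rewrite lez_nat le_dg ltNyr.
have exP : exists h, P h by exists (size d + j)%N.
case: (ex_minnP exP) => h Ph minh; exists h; split=> // -[i|i] Pi.
  by rewrite lez_nat minh.
move: Pi; rewrite /ext.
have -> : (Negz i - j%:Z + 1 < 1) = true.
  by rewrite gtrDr subr_lt0 (lt_le_trans (y := 0)).
by rewrite ltxx.
Qed.

(* g <' (d, a), for decreasing d and g such that size g = size d + size a. *)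
Definition gen_major (g d a : seq int) : Prop :=
  let k := size d in let t := size a in
  [/\ forall i : nat, (1 <= i <= k)%N ->
        (ext g (i + t)%N%:Z <= ext d i%:Z)%E,
      forall j h : nat, (1 <= j <= t)%N -> hindex d g j h ->
        \sum_(0 <= i < h) g`_i - \sum_(0 <= i < h - j) d`_i
          <= \sum_(0 <= i < j) a`_i
    & \sum_(0 <= i < k + t) g`_i
        = \sum_(0 <= i < k) d`_i + \sum_(0 <= i < t) a`_i].

Lemma gen_major_nil (g d : seq int) :
  size g = size d -> gen_major g d [::] <-> g = d.
Proof.
move=> sz; split=> [[ge_dg _]|->]; last first.
  split=> [i _|j h|]; first by rewrite addn0.
  - by case: j.
  - by rewrite /= addn0 [X in _ + X]big_geq // addr0.
rewrite /= addn0 [X in _ + X]big_geq // addr0 => sum_eq.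
have le_gd (i : nat) : (i < size d)%N -> g`_i <= d`_i.
  move=> lt_i; have := ge_dg i.+1 lt_i.
  by rewrite /ext addn0 sz lez_nat lt_i /= lee_fin subn1.
apply: (@eq_from_nth _ 0) => // i; rewrite sz => lt_i.
apply/eqP; rewrite -subr_eq0 -oppr_eq0 opprB; apply/eqP.
have : \sum_(i < size d) (d`_i - g`_i) = 0.
  by rewrite sumrB -!(big_mkord xpredT (fun i => _`_i)) sum_eq subrr.
move=> /eqP; rewrite psumr_eq0 => [|k _]; last by rewrite subr_ge0 le_gd.
by move=> /allP/(_ (Ordinal lt_i) (mem_index_enum _))/eqP.
Qed.

(* The sequence (s, 0, ..., 0) of length t: its partial sums of order 1, ..., t
   all equal s. *)
Definition head_seq (s : int) (t : nat) : seq int :=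
  mkseq (fun i => if i == 0%N then s else 0) t.

Lemma head_seq_sum (s : int) (t j : nat) : (1 <= j <= t)%N ->
  \sum_(0 <= i < j) (head_seq s t)`_i = s.
Proof.
case: j => // j /= le_jt; rewrite big_nat_recl // nth_mkseq //=; last first.
  exact: leq_ltn_trans le_jt.
rewrite big_nat big1 ?addr0 // => i /andP[_ lt_ij].
by rewrite nth_mkseq // (leq_trans _ le_jt).
Qed.

(* Main.v *)
Require Import Defs.
From mathcomp Require Import all_boot all_order all_algebra.
From mathcomp Require Import fraction constructive_ereal generic_quotient zify.

Set Implicit Arguments.
Unset Strict Implicit.
Unset Printing Implicit Defensive.

Import Order.TTheory GRing.Theory Num.Theory.
Local Open Scope ring_scope.

(**
   Vectors of a subspace of rational functions are written as rows of polynomial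
   matrices, so that the left kernel of R is [kermx R] and its right kernel is
   [kermx R^T].  By Forney's theorem, a polynomial basis of a subspace has least
   degree sum exactly when it is primitive (every polynomial vector of the
   subspace is a polynomial combination of it) and reduced (its leading
   coefficient rows are linearly independent); see [least_degree_primitive],
   [least_degree_reduced] and [minimal_least_degree].  Consequently a vector of
   degree at most D only involves the basis rows of degree at most D, and for
   every D a subspace has at most as many minimal indices i <= D as the space
   that contains it ([count_degrees_sub]).

   Necessity.  The right kernel of the completed matrix is a subspace of
   codimension x of that of R.  At the index h, where d falls below c, the parts
   of both kernels spanned by low-degree vectors have the same dimension, hence
   coincide, and the tails of d and c agree ([subspace_tail]).  The left kernel
   of R is what remains of the left kernel of the completed matrix when its last
   z coordinates are set to 0.  Intersecting a subspace with a coordinate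
   hyperplane does not increase its degree, by a Euclidean algorithm on that
   coordinate of a basis ([euclid_coordinate]); applied to the low-degree part of
   the larger kernel, this bounds the tail sums of u by those of v
   ([restriction_tail]), which is the majorization.

   Sufficiency.  A subspace of the right kernel with indices d is obtained from
   a minimal basis C by taking the rows X^(d_i - c_(i+x-1)) C_(i+x-1) + C_(i+x)
   for i <= h - x and C_(i+x) for the other i ([subspace_exists]); the x rows of
   a complement of the row space of R in the orthogonal of that subspace cut it
   out without changing the left kernel ([complementary_poly_rows],
   [has_left_indices_independent]).  The remaining z - x rows are taken of the
   form X R with X polynomial, so they do not change the right kernel and are
   polynomial when R is.  They are added one at a time: the majorization splits
   into insertions of a single index, each of which lowers some larger indices
   by at most the inserted one in total ([completable_insert]), and one such
   insertion is realized by an explicit change of basis ([add_row]).  There the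
   hypothesis r >= 1 provides a direction outside the leading rows of the left
   kernel, which makes the new index as large as required.
*)

(** * Polynomial matrices and their row degrees *)

Section PolyRows.
Variable F : fieldType.
Local Notation K := (ratfun F).
Local Notation tofrac := (@tofrac {poly F}).

Lemma ratmxM m n p (A : 'M[{poly F}]_(m, n)) (B : 'M_(n, p)) :
  ratmx (A *m B) = ratmx A *m ratmx B.
Proof. exact: map_mxM. Qed.

Lemma ratmxZ m n (a : {poly F}) (A : 'M_(m, n)) :
  ratmx (a *: A) = tofrac a *: ratmx A.
Proof. exact: map_mxZ. Qed.

Lemma ratmx_inj m n : injective (@ratmx F m n).
Proof.
move=> A B /matrixP eqAB; apply/matrixP=> i j.
by have := eqAB i j; rewrite !mxE => /eqP; rewrite tofrac_eq => /eqP.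
Qed.

Lemma ratmx_row m n i (A : 'M[{poly F}]_(m, n)) :
  ratmx (row i A) = row i (ratmx A).
Proof. exact: map_row. Qed.

Lemma frac_quotient (f : K) : exists a b : {poly F}, b != 0 /\ f * tofrac b = tofrac a.
Proof.
elim/quotW: f => r; exists \n_r, \d_r; split; first exact: denom_ratioP.
unlock FracField.tofrac; rewrite -[LHS]FracField.pi_mul; apply/eqP.
rewrite FracField.equivf_def /FracField.mulf !numden_Ratio ?mulf_neq0 ?oner_neq0 //.
all: by rewrite ?denom_ratioP ?mulr1 1?mulrC.
Qed.

Lemma clear_denominators m n (A : 'M[K]_(m, n)) :
  exists2 a : {poly F}, a != 0 & exists P, tofrac a *: A = ratmx P.
Proof.
have H (ij : 'I_m * 'I_n) : exists ab : {poly F} * {poly F},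
    (ab.2 != 0) && (A ij.1 ij.2 * tofrac ab.2 == tofrac ab.1).
  have [a [b [b0 /eqP e]]] := frac_quotient (A ij.1 ij.2).
  by exists (a, b); rewrite b0.
pose g ij := xchoose (H ij); have gP ij : (g ij).2 != 0 := proj1 (andP (xchooseP (H ij))).
have gE ij : A ij.1 ij.2 * tofrac (g ij).2 = tofrac (g ij).1.
  exact/eqP/(proj2 (andP (xchooseP (H ij)))).
exists (\prod_ij (g ij).2); first by apply/prodf_neq0.
exists (\matrix_(i, j) ((g (i, j)).1 * \prod_(kl | kl != (i, j)) (g kl).2)).
apply/matrixP=> i j; rewrite !mxE (bigD1 (i, j)) //= !rmorphM /= -gE /=.
by rewrite mulrC mulrA.
Qed.

Definition rdeg q k (B : 'M[{poly F}]_(q, k)) (i : 'I_q) : nat :=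
  vdeg (row i B)^T.

Lemma vdeg_leP k (v : 'cV[{poly F}]_k) D :
  reflect (forall i, (size (v i ord0) <= D.+1)%N) (vdeg v <= D)%N.
Proof.
rewrite /vdeg -subn1 leq_subLR add1n.
by apply: (iffP (bigmax_leqP _ _ _)) => H i *; apply: H.
Qed.

Lemma rdeg_leP q k (B : 'M[{poly F}]_(q, k)) i D :
  reflect (forall j, (size (B i j) <= D.+1)%N) (rdeg B i <= D)%N.
Proof. by apply: (iffP (vdeg_leP _ _)) => H j; have := H j; rewrite !mxE. Qed.

Lemma size_rdeg q k (B : 'M[{poly F}]_(q, k)) i j : (size (B i j) <= (rdeg B i).+1)%N.
Proof. by move: j; apply/rdeg_leP. Qed.

(** The leading row coefficient matrix when e lists the row degrees.  The degrees
    are a parameter because a construction fixes them before the row degrees are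
    known. *)
Definition leadmx q k (e : 'I_q -> nat) (B : 'M[{poly F}]_(q, k)) : 'M[F]_(q, k) :=
  \matrix_(i, j) (B i j)`_(e i).

Lemma coefM_top (p s : {poly F}) a b : (size p <= a.+1)%N -> (size s <= b.+1)%N ->
  (p * s)`_(a + b) = p`_a * s`_b.
Proof.
move=> sp ss; rewrite coefM (bigD1 (inord a : 'I_(a + b).+1)) //= inordK ?ltnS ?leq_addr //.
rewrite addKn big1 ?addr0 // => i /eqP ia.
have [lt|ge] := ltnP a i.
  by rewrite nth_default ?mul0r // (leq_trans sp).
rewrite [X in _ * X]nth_default ?mulr0 // (leq_trans ss) //.
have : (i != a :> nat).
  apply/eqP=> e; apply: ia; apply: val_inj.
  by rewrite /= inordK // ltnS leq_addr.
lia.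
Qed.

(** The parts of top degree of the products p_i B_i cannot cancel: at the highest
    degree reached they form a combination of the rows of the leading matrix,
    weighted by leading coefficients of the p_i. *)
Lemma predictable_degree q k (B : 'M[{poly F}]_(q, k)) (e : 'I_q -> nat)
    (p : 'rV[{poly F}]_q) N :
    (forall i j, (size (B i j) <= (e i).+1)%N) -> row_free (leadmx e B) ->
    (forall j, (size ((p *m B) ord0 j) <= N)%N) ->
  forall i, p ord0 i != 0 -> (size (p ord0 i) + e i <= N)%N.
Proof.
move=> sB fB sy i0 pi0; rewrite leqNgt; apply/negP=> gtN.
case: (@arg_maxnP _ i0 (fun i => p ord0 i != 0) (fun i => size (p ord0 i) + e i)%N pi0).
move=> i pi maxi; have {}gtN := leq_trans gtN (maxi _ pi0).
set M := (size (p ord0 i) + e i)%N in gtN maxi.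
(* Coefficients that contribute to degree M - 1 of the combination; an entry is
   nonzero exactly when its index reaches the maximum M. *)
pose c : 'rV[F]_q := \row_l (p ord0 l)`_(M.-1 - e l).
have spi : (0 < size (p ord0 i))%N by rewrite size_poly_gt0.
have szp l : (size (p ord0 l) <= (M.-1 - e l).+1)%N.
  have [->|pl] := eqVneq (p ord0 l) 0; first by rewrite size_poly0.
  by have := maxi l pl; rewrite /M; lia.
have : c *m leadmx e B = 0.
  apply/rowP=> j; rewrite !mxE.
  have := sy j; rewrite mxE => /leq_sizeP/(_ M.-1); rewrite coef_sum => sy0.
  rewrite -[RHS]sy0; last by move: gtN; rewrite /M; lia.
  apply: eq_bigr => l _; rewrite !mxE.
  have [pl|pl] := eqVneq (p ord0 l) 0; first by rewrite pl mul0r !coef0 mul0r.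
  rewrite -coefM_top //; congr (_`_ _).
  have := maxi l pl; have: (0 < size (p ord0 l))%N by rewrite size_poly_gt0.
  by rewrite /M; lia.
move/eqP; rewrite -[0](mul0mx _ (leadmx e B)) => /eqP/(row_free_inj fB)/rowP/(_ i)/eqP.
rewrite !mxE /M (_ : _ - _ = (size (p ord0 i)).-1)%N; last by lia.
by rewrite -/(lead_coef _) lead_coef_eq0 (negPf pi).
Qed.

Lemma ratmx_free q k (B : 'M[{poly F}]_(q, k)) :
  (forall p : 'rV_q, p *m B = 0 -> p = 0) -> row_free (ratmx B).
Proof.
move=> H; apply: inj_row_free => v vB.
have [a a0 [P aP]] := clear_denominators v.
have: ratmx (P *m B) = ratmx 0.
  by rewrite ratmxM -aP -scalemxAl vB scaler0 /ratmx map_mx0.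
move/ratmx_inj/H => P0; apply/eqP; have: tofrac a *: v == 0.
  by rewrite aP P0 /ratmx map_mx0.
by rewrite scaler_eq0 tofrac_eq0 (negPf a0).
Qed.

Lemma reduced_row_free q k (B : 'M[{poly F}]_(q, k)) (e : 'I_q -> nat) :
    (forall i j, (size (B i j) <= (e i).+1)%N) -> row_free (leadmx e B) ->
  row_free (ratmx B).
Proof.
move=> sB fB; apply: ratmx_free => p pB; apply/rowP=> i; rewrite mxE.
apply/eqP/negPn/negP => pi.
have: (size (p ord0 i) + e i <= 0)%N.
  by apply: (predictable_degree sB fB) pi => j; rewrite pB mxE size_poly0.
by rewrite leqn0 addn_eq0 size_poly_eq0 (negPf pi).
Qed.
End PolyRows.

(** * Minimal bases as primitive and reduced matrices *)

Section Forney.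
Variable F : fieldType.
Local Notation K := (ratfun F).
Local Notation tofrac := (@tofrac {poly F}).

Definition reduced q k (B : 'M[{poly F}]_(q, k)) : bool :=
  row_free (leadmx (rdeg B) B).

Definition primitive q k (B : 'M[{poly F}]_(q, k)) : Prop :=
  forall y : 'rV_k, (ratmx y <= ratmx B)%MS -> exists p, y = p *m B.

Definition minimal_mx q k (B : 'M[{poly F}]_(q, k)) : Prop :=
  primitive B /\ reduced B.

Lemma minimal_row_free q k (B : 'M[{poly F}]_(q, k)) :
  minimal_mx B -> row_free (ratmx B).
Proof. by case=> _; apply: reduced_row_free; apply: size_rdeg. Qed.

Lemma row_free_mul_eq0 (L : fieldType) p q k (A : 'M[L]_(q, k)) (v : 'M_(p, q)) :
  row_free A -> v *m A = 0 -> v = 0.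
Proof. by move=> fA vA; apply: (row_free_inj fA); rewrite mul0mx. Qed.

Lemma row_free_row_neq0 (L : fieldType) q k (A : 'M[L]_(q, k)) i : row_free A -> row i A != 0.
Proof.
move=> fA; apply/eqP; rewrite rowE => /(row_free_mul_eq0 fA)/rowP/(_ i)/eqP.
by rewrite !mxE !eqxx oner_eq0.
Qed.

(** A free leading matrix has no zero row, so the degree bounds are attained. *)
Lemma rdeg_leadmx q k (B : 'M[{poly F}]_(q, k)) (e : 'I_q -> nat) :
    (forall i j, (size (B i j) <= (e i).+1)%N) -> row_free (leadmx e B) ->
  forall i, rdeg B i = e i.
Proof.
move=> sB fB i; apply/eqP; rewrite eqn_leq; apply/andP; split; first exact/rdeg_leP.
have /eqP/rowP := row_free_row_neq0 i fB; rewrite leqNgt => H; apply/negP=> lt.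
apply: H => j; rewrite !mxE nth_default // (leq_trans (size_rdeg _ _ _)) //.
Qed.

Lemma minimal_mxI q k (B : 'M[{poly F}]_(q, k)) (e : 'I_q -> nat) :
    (forall i j, (size (B i j) <= (e i).+1)%N) -> row_free (leadmx e B) ->
  primitive B -> minimal_mx B /\ forall i, rdeg B i = e i.
Proof.
move=> sB fB pB; have eB := rdeg_leadmx sB fB; split=> //; split=> //.
rewrite /reduced; suff -> : leadmx (rdeg B) B = leadmx e B by [].
by apply/matrixP=> i j; rewrite !mxE eB.
Qed.

Definition least_degree q k (B : 'M[{poly F}]_(q, k)) : Prop :=
  forall B' : 'M_(q, k), row_free (ratmx B') -> (ratmx B' :=: ratmx B)%MS ->
    (\sum_i rdeg B i <= \sum_i rdeg B' i)%N.

Lemma eqmx_row_free (L : fieldType) q k (A B : 'M[L]_(q, k)) :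
  (A :=: B)%MS -> row_free A = row_free B.
Proof. by move=> eqAB; rewrite /row_free eqAB. Qed.

Definition replace_row (L : Type) q k (B : 'M[L]_(q, k)) i0 (y : 'rV_k) : 'M_(q, k) :=
  \matrix_(i < q) (if i == i0 then y else row i B).

Lemma replace_row_eqmx (L : fieldType) q k (B : 'M[L]_(q, k)) i0 (w : 'rV_q) :
  w ord0 i0 != 0 -> (replace_row B i0 (w *m B) :=: B)%MS.
Proof.
move=> wi0; apply/eqmxP/andP; split.
  apply/row_subP=> i; rewrite rowK; case: eqP => _; first exact: submxMl.
  exact: row_sub.
set A := replace_row _ _ _.
have rA i : i != i0 -> (row i B <= A)%MS.
  by move=> ne; have := row_sub i A; rewrite rowK (negPf ne).
apply/row_subP=> i; have [->|] := eqVneq i i0; last exact: rA.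
have: (w *m B <= A)%MS by have := row_sub i0 A; rewrite rowK eqxx.
rewrite mulmx_sum_row (bigD1 i0) //= => H.
have: (w ord0 i0 *: row i0 B <= A)%MS.
  rewrite -[X in (X <= _)%MS](addrK (\sum_(j | j != i0) w ord0 j *: row j B)).
  rewrite addmx_sub // eqmx_opp summx_sub // => j ne; exact/scalemx_sub/rA.
by rewrite (eqmx_scale _ wi0).
Qed.

Lemma ratmx_replace_row q k (B : 'M[{poly F}]_(q, k)) i0 y :
  ratmx (replace_row B i0 y) = replace_row (ratmx B) i0 (ratmx y).
Proof. by apply/matrixP=> i j; rewrite !mxE; case: eqP; rewrite !mxE. Qed.

Lemma rdeg_replace_row q k (B : 'M[{poly F}]_(q, k)) i0 y i :
  rdeg (replace_row B i0 y) i = if i == i0 then rdeg y ord0 else rdeg B i.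
Proof. by rewrite /rdeg rowK row_id; case: eqP. Qed.

(** A vector may replace any basis row that it involves; when the degree sum is
    least, this cannot lower it. *)
Lemma exchange_degree q k (B : 'M[{poly F}]_(q, k)) (y : 'rV_k) (w : 'rV[K]_q) i0 :
    row_free (ratmx B) -> least_degree B -> ratmx y = w *m ratmx B ->
  w ord0 i0 != 0 -> (rdeg B i0 <= rdeg y ord0)%N.
Proof.
move=> fB minB yw wi0.
have eqB : (ratmx (replace_row B i0 y) :=: ratmx B)%MS.
  by rewrite ratmx_replace_row yw; apply: replace_row_eqmx.
have := minB _ _ eqB; rewrite (eqmx_row_free eqB) fB => /(_ isT).
rewrite (bigD1 i0) //= [X in (_ <= X)%N](bigD1 i0) //= rdeg_replace_row eqxx.
rewrite [X in (_ <= _ + X)%N](eq_bigr (rdeg B)) ?leq_add2r // => i ne.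
by rewrite rdeg_replace_row (negPf ne).
Qed.

(** A dependency between leading rows, with powers of X aligning the degrees,
    yields a vector of smaller degree than the largest row that it involves,
    against [exchange_degree]. *)
Lemma least_degree_reduced q k (B : 'M[{poly F}]_(q, k)) :
  row_free (ratmx B) -> least_degree B -> reduced B.
Proof.
move=> fB minB; apply: inj_row_free => c cB; apply/eqP/negPn/negP => c0.
have [l0 cl0] : exists l, c ord0 l != 0.
  by apply/existsP; apply: contraR c0; rewrite negb_exists => /forallP H;
     apply/eqP/rowP=> l; rewrite mxE; apply/eqP/negPn.
case: (@arg_maxnP _ l0 (fun i => c ord0 i != 0) (rdeg B) cl0) => i0 ci0 maxi0.
pose p : 'rV[{poly F}]_q := \row_i (c ord0 i *: 'X^(rdeg B i0 - rdeg B i)).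
have sy j : (size ((p *m B) ord0 j) <= rdeg B i0)%N.
  apply/leq_sizeP=> N leN; rewrite mxE coef_sum.
  have -> : \sum_i (p ord0 i * B i j)`_N = \sum_i c ord0 i * (B i j)`_(rdeg B i + (N - rdeg B i0)).
    apply: eq_bigr => i _; rewrite !mxE -scalerAl coefZ coefXnM.
    have [->|ci] := eqVneq (c ord0 i) 0; first by rewrite !mul0r.
    have := maxi0 i ci; case: ifP => [|_ le]; first by move: leN; lia.
    by congr (_ * _`_ _); lia.
  move: leN; rewrite leq_eqVlt => /orP[/eqP<-|lt].
    rewrite subnn; have /rowP/(_ j) := cB; rewrite !mxE => cB0.
    by rewrite -[RHS]cB0; apply: eq_bigr => i _; rewrite !mxE addn0.
  rewrite big1 // => i _; rewrite nth_default ?mulr0 //.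
  by rewrite (leq_trans (size_rdeg _ _ _)) //; lia.
have pi0 : ratmx p ord0 i0 != 0.
  by rewrite !mxE tofrac_eq0 subnn expr0 scaler_eq0 (negPf ci0) oner_eq0.
have /exchange_degree := pi0; move/(_ _ _ _ fB minB (ratmxM _ _)).
(* [vdeg] is 0 for constant vectors and for zero alike, so when the largest row
   involved is constant the contradiction is that the combination vanishes. *)
have [E0|Egt0] := posnP (rdeg B i0); last first.
  move=> leE; have : (rdeg (p *m B) ord0 <= (rdeg B i0).-1)%N.
    by apply/rdeg_leP=> j; rewrite prednK.
  by move: leE Egt0; lia.
have pB0 : p *m B = 0.
  by apply/rowP=> j; rewrite [RHS]mxE; apply/eqP; have := sy j; rewrite E0 size_poly_leq0.
move=> _; have : ratmx p *m ratmx B = 0 by rewrite -ratmxM pB0 /ratmx map_mx0.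
move=> /(row_free_mul_eq0 fB) p0.
by move: pi0; rewrite p0 mxE eqxx.
Qed.

(** If the coordinates of y have common denominator a, divide their numerators by
    a.  The remainders define a polynomial vector whose coordinates are proper
    fractions, so its degree is smaller than that of the largest row that it
    involves; by [exchange_degree] it is zero. *)
Lemma least_degree_primitive q k (B : 'M[{poly F}]_(q, k)) :
  row_free (ratmx B) -> least_degree B -> primitive B.
Proof.
move=> fB minB y /submxP[w yw].
have [a a0 [p ap]] := clear_denominators w.
have ya : a *: y = p *m B.
  by apply: ratmx_inj; rewrite ratmxZ ratmxM -ap yw scalemxAl.
pose s : 'rV_q := map_mx (fun f => f %/ a) p; pose r : 'rV_q := map_mx (fun f => f %% a) p.
have pE : p = a *: s + r by apply/matrixP=> i j; rewrite !mxE mulrC -divp_eq.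
exists s; apply/eqP; rewrite -subr_eq0; set y' := _ - _.
have y'E : a *: y' = r *m B.
  by rewrite scalerBr ya pE mulmxDl -scalemxAl addrAC subrr add0r.
(* Only the equation y'E matters from here on; an opaque y' keeps mxE from
   unfolding it. *)
clearbody y'.
have y'w : ratmx y' = ((tofrac a)^-1 *: ratmx r) *m ratmx B.
  rewrite -scalemxAl -ratmxM -y'E ratmxZ scalerA mulVf ?scale1r //.
  by rewrite tofrac_eq0.
case: (pickP (fun i => r ord0 i != 0)) => [l0 rl0|r0]; last first.
  have {}r0 : r = 0 by apply/rowP=> i; rewrite [RHS]mxE; apply/eqP; have /negbFE := r0 i.
  apply/eqP/rowP=> j; have /rowP/(_ j)/eqP := y'E.
  by rewrite r0 mul0mx !mxE mulf_eq0 (negPf a0) => /eqP.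
case: (@arg_maxnP _ l0 (fun i => r ord0 i != 0) (rdeg B) rl0) => i0 ri0 maxi0.
have: (rdeg B i0 <= rdeg y' ord0)%N.
  apply: (exchange_degree fB minB y'w).
  by rewrite !mxE mulf_neq0 ?invr_eq0 ?tofrac_eq0 //; move: ri0; rewrite mxE.
have sr j : (size (a * y' ord0 j)%R <= (size a).-1 + rdeg B i0)%N.
  have -> : a * y' ord0 j = (a *: y') ord0 j by rewrite mxE.
  rewrite y'E mxE; apply: (leq_trans (size_sum _ _ _)); apply/bigmax_leqP=> i _.
  have [->|ri] := eqVneq (r ord0 i) 0; first by rewrite mul0r size_poly0.
  have le : (rdeg B i <= rdeg B i0)%N := maxi0 i ri.
  apply: (leq_trans (size_polyMleq _ _)); have := size_rdeg B i j.
  have : (size (r ord0 i) < size a)%N by rewrite mxE ltn_modp.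
  have : (0 < size a)%N by rewrite size_poly_gt0.
  case: (size a) => //= sa _; rewrite ltnS => lt_r le_B.
  rewrite -subn1 leq_subLR add1n -addnS; apply: leq_add => //.
  exact: leq_trans le_B _.
have sy j : (size (y' ord0 j) <= rdeg B i0)%N.
  have [->|yj] := eqVneq (y' ord0 j) 0; first by rewrite size_poly0.
  have := sr j; rewrite size_mul //.
  have : (0 < size a)%N by rewrite size_poly_gt0.
  by case: (size a) => //= sa _; rewrite leq_add2l.
have [E0 _|Egt0] := posnP (rdeg B i0).
  by apply/eqP/rowP=> j; rewrite [RHS]mxE; apply/eqP; have := sy j; rewrite E0 size_poly_leq0.
move=> leE; have : (rdeg y' ord0 <= (rdeg B i0).-1)%N.
  by apply/rdeg_leP=> j; rewrite prednK.
by move: leE Egt0; lia.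
Qed.

End Forney.

(** * Decreasing sequences compared by counting small entries *)

Section DecreasingSequences.

Lemma sumn_drop n s : sumn (drop n s) = (\sum_(n <= i < size s) nth 0%N s i)%N.
Proof.
rewrite sumnE (big_nth 0%N) size_drop -[n in RHS]add0n big_addn.
by apply: eq_bigr => i _; rewrite nth_drop addnC.
Qed.

Lemma sorted_geq_nth s i j : sorted geq s -> (i <= j)%N -> (nth 0%N s j <= nth 0%N s i)%N.
Proof.
move=> ss le_ij; have [lt|ge] := ltnP j (size s); last by rewrite nth_default.
have gt : transitive geq by move=> x y z /= xy yz; apply: leq_trans yz xy.
by apply: (sorted_leq_nth gt leqnn 0%N ss) => //; apply: leq_ltn_trans le_ij lt.
Qed.

Lemma sorted_geqP (s : seq nat) :
  (forall i, (i.+1 < size s)%N -> (nth 0%N s i.+1 <= nth 0%N s i)%N) -> sorted geq s.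
Proof.
by move=> H; apply/(sortedP 0%N) => i lt; apply: H.
Qed.

Lemma count_le_lower (s : seq nat) i D : sorted geq s -> (nth 0%N s i <= D)%N ->
  (size s - i <= count (fun d => d <= D) s)%N.
Proof.
move=> ss le; rewrite -{2}(cat_take_drop i s) count_cat -size_drop.
rewrite [X in (_ <= _ + X)%N](_ : _ = size (drop i s)) ?leq_addl //.
apply/eqP; rewrite -all_count; apply/(all_nthP 0%N) => j _.
by rewrite nth_drop (leq_trans _ le) // sorted_geq_nth // leq_addr.
Qed.

Lemma count_le_upper (s : seq nat) i D : sorted geq s -> (D < nth 0%N s i)%N ->
  (count (fun d => d <= D) s <= size s - i.+1)%N.
Proof.
move=> ss lt; rewrite -{1}(cat_take_drop i.+1 s) count_cat -size_drop.
rewrite [X in (X + _ <= _)%N](_ : _ = 0%N) ?count_size //.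
apply/eqP; rewrite -leqn0 leqNgt -has_count -all_predC; apply/(all_nthP 0%N) => j.
rewrite size_take_min leq_min => /andP[ji _]; rewrite nth_take //= -ltnNge (leq_trans lt) //.
exact: sorted_geq_nth.
Qed.

(** Sequences of different lengths are aligned at their ends, where the small
    entries are. *)
Lemma dominated_nth (s s' : seq nat) : sorted geq s -> sorted geq s' ->
    (size s' <= size s)%N ->
    (forall D, count (fun d => d <= D) s' <= count (fun d => d <= D) s)%N ->
  forall i, (i < size s')%N -> (nth 0%N s (i + (size s - size s')) <= nth 0%N s' i)%N.
Proof.
move=> ss ss' le_s le_count i lt_i; rewrite leqNgt; apply/negP => lt.
have := count_le_upper ss lt; have := count_le_lower ss' (leqnn (nth 0%N s' i)).
have := le_count (nth 0%N s' i); lia.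
Qed.

Lemma dominated_sumn (s s' : seq nat) : sorted geq s -> (size s' <= size s)%N ->
    (forall D, count (fun d => d <= D) s' <= count (fun d => d <= D) s)%N ->
  (sumn (drop (size s - size s') s) <= sumn s')%N.
Proof.
move=> ss le_s le_count; set s1 := sort geq s'.
have p1 : perm_eq s1 s' by rewrite perm_sort.
have z1 := perm_size p1.
have ss1 : sorted geq s1 by apply: sort_sorted => a b; apply: leq_total.
rewrite -(perm_sumn p1) -[X in (_ <= sumn X)%N]drop0 !sumn_drop z1.
rewrite -{1}[(size s - size s')%N]add0n big_addn subKn // !big_nat.
apply: leq_sum => i /andP[_ lt]; rewrite -z1; apply: dominated_nth; rewrite ?z1 //.
by move=> D; move/permP: p1 => ->.
Qed.

End DecreasingSequences.

(** * Minimal indices of subspaces *)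

Section Comparison.
Variable F : fieldType.
Local Notation K := (ratfun F).

Lemma rowsub_row_free (L : fieldType) q q' k (f : 'I_q' -> 'I_q) (A : 'M[L]_(q, k)) :
  injective f -> row_free A -> row_free (rowsub f A).
Proof.
move=> injf fA; apply: inj_row_free => v.
rewrite -[A]mul1mx -mul_rowsub_mx mulmxA => /(row_free_mul_eq0 fA) /rowP v0.
apply/rowP=> i; have := v0 (f i); rewrite !mxE (bigD1 i) //= !mxE eqxx mulr1.
by rewrite big1 ?addr0 // => j ne; rewrite !mxE (inj_eq injf) (negPf ne) mulr0.
Qed.

Definition subrows (L : Type) q k (A : {set 'I_q}) (B : 'M[L]_(q, k)) : 'M_(#|A|, k) :=
  rowsub (@enum_val _ (mem A)) B.

Lemma row_sub_subrows (L : fieldType) q k (A : {set 'I_q}) (B : 'M[L]_(q, k)) i :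
  i \in A -> (row i B <= subrows A B)%MS.
Proof.
by move=> iA; have := row_sub (enum_rank_in iA i) (subrows A B);
   rewrite row_rowsub enum_rankK_in.
Qed.

Lemma subrows_free (L : fieldType) q k (A : {set 'I_q}) (B : 'M[L]_(q, k)) :
  row_free B -> row_free (subrows A B).
Proof. exact/rowsub_row_free/enum_val_inj. Qed.

Lemma ratmx_subrows q k (A : {set 'I_q}) (B : 'M[{poly F}]_(q, k)) :
  ratmx (subrows A B) = subrows A (ratmx B).
Proof. by apply/matrixP=> i j; rewrite !mxE. Qed.

Lemma minimal_coordinates q k (B : 'M[{poly F}]_(q, k)) (y : 'rV_k) :
  minimal_mx B -> (ratmx y <= ratmx B)%MS ->
  exists2 p, y = p *m B &
    forall i, p ord0 i != 0 -> (size (p ord0 i) + rdeg B i <= (rdeg y ord0).+1)%N.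
Proof.
move=> [pB rB] /pB[p yp]; exists p => //.
apply: predictable_degree (@size_rdeg _ _ _ B) rB _ => j; rewrite -yp; exact: size_rdeg.
Qed.

Lemma rdeg_row q k (B : 'M[{poly F}]_(q, k)) i : rdeg (row i B) ord0 = rdeg B i.
Proof. by rewrite /rdeg row_id. Qed.

(** By predictable degree, a vector has zero coordinates on the basis rows of
    larger degree. *)
Lemma low_degree_sub q q' k (B : 'M[{poly F}]_(q, k)) (B' : 'M_(q', k))
    (A : {set 'I_q}) (A' : {set 'I_q'}) :
    minimal_mx B -> (ratmx B' <= ratmx B)%MS ->
    (forall i j, i \in A' -> j \notin A -> rdeg B' i < rdeg B j)%N ->
  (subrows A' (ratmx B') <= subrows A (ratmx B))%MS.
Proof.
move=> minB sB' degA; apply/row_subP => a; rewrite row_rowsub.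
set i := enum_val a; have iA : i \in A' := enum_valP a.
have : (ratmx (row i B') <= ratmx B)%MS.
  by rewrite ratmx_row (submx_trans (row_sub _ _)).
case/(minimal_coordinates minB) => p yp dp; rewrite -ratmx_row yp ratmxM mulmx_sum_row.
apply: summx_sub => j _; have [jA|jA] := boolP (j \in A).
  exact/scalemx_sub/row_sub_subrows.
have [p0|/dp] := eqVneq (p ord0 j) 0; first by rewrite mxE p0 rmorph0 scale0r sub0mx.
have := degA _ _ iA jA; rewrite rdeg_row => lt le.
have [/eqP|] := posnP (size (p ord0 j)); last by lia.
by rewrite size_poly_eq0 => /eqP p0; rewrite mxE p0 rmorph0 scale0r sub0mx.
Qed.

Lemma low_degree_card q q' k (B : 'M[{poly F}]_(q, k)) (B' : 'M_(q', k))
    (A : {set 'I_q}) (A' : {set 'I_q'}) :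
    minimal_mx B -> row_free (ratmx B') -> (ratmx B' <= ratmx B)%MS ->
    (forall i j, i \in A' -> j \notin A -> rdeg B' i < rdeg B j)%N ->
  (#|A'| <= #|A|)%N.
Proof.
move=> minB fB' sB' degA; have := mxrankS (low_degree_sub minB sB' degA).
by rewrite (eqP (subrows_free _ fB')) => /leq_trans; apply; apply: rank_leq_row.
Qed.

Definition degrees q k (B : 'M[{poly F}]_(q, k)) : seq nat := codom (rdeg B).

Lemma size_degrees q k (B : 'M[{poly F}]_(q, k)) : size (degrees B) = q.
Proof. by rewrite size_codom card_ord. Qed.

Lemma sumn_degrees q k (B : 'M[{poly F}]_(q, k)) : sumn (degrees B) = (\sum_i rdeg B i)%N.
Proof. by rewrite sumnE /degrees codomE big_map big_enum. Qed.

Lemma count_degrees q k (B : 'M[{poly F}]_(q, k)) D :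
  count (fun d => d <= D)%N (degrees B) = #|[set i | (rdeg B i <= D)%N]|.
Proof.
rewrite /degrees codomE count_map -size_filter cardsE cardE /enum_mem.
by rewrite -filter_predI; congr size; apply: eq_filter => i; rewrite /= andbT.
Qed.

Lemma nth_degrees q k (B : 'M[{poly F}]_(q, k)) (i : 'I_q) : nth 0%N (degrees B) i = rdeg B i.
Proof.
rewrite /degrees codomE (nth_map i) ?size_enum_ord //.
by rewrite nth_ord_enum.
Qed.

Lemma count_degrees_sub q q' k (B : 'M[{poly F}]_(q, k)) (B' : 'M_(q', k)) D :
    minimal_mx B -> row_free (ratmx B') -> (ratmx B' <= ratmx B)%MS ->
  (count (fun d => d <= D) (degrees B') <= count (fun d => d <= D) (degrees B))%N.
Proof.
move=> minB fB' sB'; rewrite !count_degrees; apply: low_degree_card minB fB' sB' _.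
by move=> i j; rewrite !inE -ltnNge => /leq_ltn_trans; apply.
Qed.

(** For every D, any other basis has at most as many rows of degree at most D, so
    its degree sum is at least as large. *)
Lemma minimal_least_degree q k (B : 'M[{poly F}]_(q, k)) : minimal_mx B -> least_degree B.
Proof.
move=> minB B' fB' eqB; rewrite -!sumn_degrees.
have p1 : perm_eq (sort geq (degrees B)) (degrees B) by rewrite perm_sort.
have ss1 : sorted geq (sort geq (degrees B)) by apply: sort_sorted => a b; apply: leq_total.
have := @dominated_sumn (sort geq (degrees B)) (degrees B') ss1.
rewrite !(perm_size p1) !size_degrees subnn drop0 (perm_sumn p1); apply=> // D.
move/permP: p1 => ->; apply: count_degrees_sub => //; by rewrite eqB.
Qed.

End Comparison.

(** * Degrees of intersections with coordinate subspaces *)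

Section Euclid.
Variable F : fieldType.
Local Notation K := (ratfun F).

Lemma rdeg_subrows q k (A : {set 'I_q}) (B : 'M[{poly F}]_(q, k)) i :
  rdeg (subrows A B) i = rdeg B (enum_val i).
Proof. by rewrite /rdeg row_rowsub. Qed.

Lemma sum_rdeg_subrows q k (A : {set 'I_q}) (B : 'M[{poly F}]_(q, k)) :
  (\sum_i rdeg (subrows A B) i = \sum_(i in A) rdeg B i)%N.
Proof.
by rewrite [RHS]big_enum_val; apply: eq_bigr => i _; rewrite rdeg_subrows.
Qed.

(** One division step on the entries of column l, with the degree that it costs. *)
Lemma reduce_row q k (B : 'M[{poly F}]_(q, k)) (l : 'I_k) (a b : 'I_q) (E : nat) :
    a != b -> B b l != 0 -> (size (B b l) <= size (B a l))%N ->
    (rdeg B a <= E)%N -> (size (B a l) - size (B b l) + rdeg B b <= E)%N ->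
  exists B' : 'M[{poly F}]_(q, k),
    [/\ (ratmx B' :=: ratmx B)%MS, forall i, i != a -> row i B' = row i B,
        (rdeg B' a <= E)%N & (size (B' a l) < size (B b l))%N].
Proof.
move=> ab Bb0 le_ba leE leE'; set f := B a l %/ B b l.
pose w : 'rV[{poly F}]_q := delta_mx 0 a - f *: delta_mx 0 b.
have wB : w *m B = row a B - f *: row b B.
  by rewrite mulmxBl -scalemxAl -!rowE.
exists (replace_row B a (w *m B)); split.
- rewrite ratmx_replace_row ratmxM; apply: replace_row_eqmx.
  by rewrite !mxE !eqxx (negPf ab) mulr0 subr0 rmorph1 oner_neq0.
- by move=> i ia; rewrite rowK (negPf ia).
- rewrite rdeg_replace_row eqxx wB; apply/rdeg_leP => j.
  rewrite !mxE; apply: (leq_trans (size_polyD _ _)); rewrite size_polyN geq_max.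
  rewrite (leq_trans (size_rdeg _ _ _)) //=.
  apply: (leq_trans (size_polyMleq _ _)); have sB := size_rdeg B b j.
  have: (size f <= size (B a l) - (size (B b l)).-1)%N by rewrite size_divp.
  have : (0 < size (B b l))%N by rewrite size_poly_gt0.
  move: leE' le_ba sB; move: (size _) (size _) (size _) (size _) => x1 x2 x3 x4; lia.
have -> : replace_row B a (w *m B) a l = B a l - f * B b l.
  by rewrite mxE eqxx wB !mxE.
have -> : B a l - f * B b l = B a l %% B b l.
  by rewrite {1}(divp_eq (B a l) (B b l)) -/f addrAC subrr add0r.
by rewrite ltn_modp.
Qed.

(** Euclid's algorithm on the entries of column l.  Row i comes with a degree
    bound e i, which may grow, and has slack e i - deg (B i l); the potential
    [\sum_(j | j != i) e j + deg (B i l)], that is the sum of the bounds minus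
    this slack, stays at most S for every i with a nonzero entry.  When a single
    nonzero entry is left, dropping its row gives the intersection with the
    hyperplane, and the potential bounds the degrees of the other rows.  Sizes
    are degrees plus one, whence the S.+1. *)
Lemma euclid_coordinate q k (l : 'I_k) S N : forall (B : 'M[{poly F}]_(q, k)) (e : 'I_q -> nat),
    (\sum_i size (B i l) <= N)%N -> row_free (ratmx B) ->
    (exists i, B i l != 0) ->
    (forall i, rdeg B i <= e i)%N ->
    (forall i, B i l != 0 -> (\sum_(j | j != i) e j + size (B i l) <= S.+1)%N) ->
  exists q' (B' : 'M[{poly F}]_(q', k)),
    [/\ row_free (ratmx B'),
        forall y : 'rV_k, (y <= ratmx B')%MS = (y <= ratmx B)%MS && (y ord0 l == 0)
      & (\sum_i rdeg B' i <= S)%N].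
Proof.
elim: N => [|N IH] B e leN fB [i0 Bi0] leBe leS.
  by move: leN; rewrite (bigD1 i0) //= leqn0 addn_eq0 size_poly_eq0 (negPf Bi0).
case: (@arg_minnP _ i0 (fun i => B i l != 0) (fun i => (e i).+1 - size (B i l))%N Bi0).
move=> p Bp minp {i0 Bi0}.
have sz i : B i l != 0 -> (0 < size (B i l) <= (e i).+1)%N.
  by move=> nz; rewrite size_poly_gt0 nz (leq_trans (size_rdeg _ _ _)) ?ltnS.
case: (pickP (fun i => (i != p) && (B i l != 0))) => [q0 q0P|none]; last first.
  have Bl0 i : i != p -> B i l = 0.
    by move=> ip; have := none i; rewrite ip /= => /negbFE/eqP.
  exists #|[set~ p]|, (subrows [set~ p] B); split.
  - by rewrite ratmx_subrows subrows_free.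
  - move=> y; rewrite ratmx_subrows; apply/idP/idP.
      move=> yB; apply/andP; split.
        apply: submx_trans yB _; apply/row_subP => i; rewrite row_rowsub; exact: row_sub.
      have [w ->] := submxP yB; rewrite mxE big1 // => i _; rewrite !mxE.
      by rewrite Bl0 ?rmorph0 ?mulr0 //; have := enum_valP i; rewrite !inE.
    case/andP => /submxP[w yw] yl; rewrite yw mulmx_sum_row.
    apply: summx_sub => i _; have [ip|ip] := eqVneq i p; last first.
      by apply/scalemx_sub/row_sub_subrows; rewrite !inE.
    move: yl; rewrite yw mxE (bigD1 p) //= big1 ?addr0 => [|j jp]; last first.
      by rewrite !mxE Bl0 ?rmorph0 ?mulr0.
    by rewrite mulf_eq0 mxE tofrac_eq0 (negPf Bp) orbF ip => /eqP->; rewrite scale0r sub0mx.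
  rewrite sum_rdeg_subrows; have := leS p Bp; have /andP[+ _] := sz p Bp.
  have : (\sum_(i in [set~ p]) rdeg B i <= \sum_(j | j != p) e j)%N.
    by rewrite (eq_bigl (fun j => j != p)) => [|i]; [apply: leq_sum | rewrite !inE].
  by move=> le1 gt le2; rewrite -ltnS; apply: leq_trans le2; rewrite -addn1 leq_add.
(* p has the smallest slack, a the second smallest.  The one with the larger
   entry is divided by the other.  Dividing a by p respects the bound of a;
   dividing p by a requires the larger bound E for p, which gives p the slack of
   a and is harmless since all other slacks are at least that of a. *)
pose Q i := (i != p) && (B i l != 0).
case: (@arg_minnP _ q0 Q (fun i => (e i).+1 - size (B i l))%N q0P).
move=> a /andP[ap Ba] mina {q0 q0P}.
have same (B' : 'M[{poly F}]_(q, k)) i : row i B' = row i B ->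
    (B' i l = B i l) * (rdeg B' i = rdeg B i).
  move=> e1; split; last by rewrite /rdeg e1.
  by move/rowP: e1 => /(_ l); rewrite !mxE.
have [le_pa|lt_ap] := leqP (size (B p l)) (size (B a l)).
  have [|B' [eqB rB' dB' sB']] := reduce_row ap Bp le_pa (leBe a).
    have := minp a Ba; have := sz p Bp; have := sz a Ba; have := leBe p.
    by move: le_pa; move: (size _) (size _) => x1 x2; lia.
  case: (IH B' e) => [||||i|q' [C [fC CE dC]]].
  - move: leN; rewrite (bigD1 a) //= [X in _ -> (X <= N)%N](bigD1 a) //=.
    rewrite [X in _ -> (_ + X <= N)%N](eq_bigr (fun i => size (B i l))) => [|i ia].
      by move=> H; rewrite -ltnS; apply: leq_trans H; rewrite ltn_add2r (leq_trans sB' le_pa).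
    by rewrite (same _ _ (rB' i ia)).
  - by rewrite (eqmx_row_free eqB).
  - by exists p; rewrite (same _ _ (rB' p _)) // eq_sym.
  - by move=> i; have [->//|ia] := eqVneq i a; rewrite (same _ _ (rB' i ia)).
  - have [->|ia] := eqVneq i a => nz; last first.
      by rewrite (same _ _ (rB' i ia)) leS // -(same _ _ (rB' i ia)).
    apply: leq_trans (leS a Ba); rewrite leq_add2l ltnW //.
    exact: leq_trans sB' le_pa.
  by exists q', C; split=> // y; rewrite CE eqB.
pose E := (size (B p l) + ((e a).+1 - size (B a l))).-1.
pose e' i := if i == p then E else e i.
have pa : p != a by rewrite eq_sym.
have [||B' [eqB rB' dB' sB']] := reduce_row pa Ba (ltnW lt_ap) (E := E).
- have := minp a Ba; have := sz p Bp; have := sz a Ba; have := leBe p; rewrite /E.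
  by move: (size _) (size _) => x1 x2; lia.
- have := minp a Ba; have := sz p Bp; have := sz a Ba; have := leBe a; rewrite /E.
  by move: lt_ap; move: (size _) (size _) => x1 x2; lia.
case: (IH B' e') => [||||i|q' [C [fC CE dC]]].
- move: leN; rewrite (bigD1 p) //= [X in _ -> (X <= N)%N](bigD1 p) //=.
  rewrite [X in _ -> (_ + X <= N)%N](eq_bigr (fun i => size (B i l))) => [|i ia].
    by move=> H; rewrite -ltnS; apply: leq_trans H; rewrite ltn_add2r (leq_trans sB' (ltnW lt_ap)).
  by rewrite (same _ _ (rB' i ia)).
- by rewrite (eqmx_row_free eqB).
- by exists a; rewrite (same _ _ (rB' a _)).
- by move=> i; rewrite /e'; case: eqP => [->//|/eqP ia]; rewrite (same _ _ (rB' i ia)).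
- have [->|ip] := eqVneq i p => nz.
    rewrite (eq_bigr e) => [|j jp]; last by rewrite /e' (negPf jp).
    apply: leq_trans (leS p Bp); rewrite leq_add2l ltnW //.
    exact: leq_trans sB' (ltnW lt_ap).
  move: nz; rewrite (same _ _ (rB' i ip)) => nz.
  pose T := (\sum_(j | (j != p) && (j != i)) e j)%N.
  have Tp : (\sum_(j | j != p) e j = e i + T)%N by rewrite (bigD1 i).
  have Ti : (\sum_(j | j != i) e' j = E + T)%N.
    rewrite (bigD1 p) 1?eq_sym //= {1}/e' eqxx; congr (_ + _)%N.
    apply: eq_big => [j|j /andP[_ jp]]; first by rewrite andbC.
    by rewrite /e' (negPf jp).
  have := leS p Bp; rewrite Tp Ti.
  have : ((e a).+1 - size (B a l) <= (e i).+1 - size (B i l))%N.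
    by apply: mina; rewrite /Q ip.
  have := sz p Bp; have := sz a Ba; have := sz i nz; rewrite /E.
  by move: (size _) (size _) (size _) T {Tp Ti} => x1 x2 x3 T; lia.
by exists q', C; split=> // y; rewrite CE eqB.
Qed.

(** A coordinate has at most the degree of the vector, so the potential of
    [euclid_coordinate] starts at the degree sum when e lists the row degrees. *)
Lemma coordinate_hyperplane q k (B : 'M[{poly F}]_(q, k)) (l : 'I_k) :
    row_free (ratmx B) ->
  exists q' (B' : 'M[{poly F}]_(q', k)),
    [/\ row_free (ratmx B'),
        forall y : 'rV_k, (y <= ratmx B')%MS = (y <= ratmx B)%MS && (y ord0 l == 0)
      & (\sum_i rdeg B' i <= \sum_i rdeg B i)%N].
Proof.
move=> fB; case: (pickP (fun i => B i l != 0)) => [i0 Bi0|none].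
  apply: (euclid_coordinate (e := rdeg B)) (leqnn _) fB _ _ _ => //; first by exists i0.
  move=> i Bi; rewrite [X in (_ <= X.+1)%N](bigD1 i) //= addnC -addSn leq_add2r.
  exact: size_rdeg.
exists q, B; split=> // y; apply/idP/andP => [yB|[]//]; split=> //.
have [w ->] := submxP yB; rewrite mxE big1 // => i _; rewrite !mxE.
by have /negbFE/eqP -> := none i; rewrite rmorph0 mulr0.
Qed.

Lemma coordinate_subspace q k (s : seq 'I_k) (B : 'M[{poly F}]_(q, k)) :
    row_free (ratmx B) ->
  exists q' (B' : 'M[{poly F}]_(q', k)),
    [/\ row_free (ratmx B'),
        forall y : 'rV_k, (y <= ratmx B')%MS = (y <= ratmx B)%MS && all (fun l => y ord0 l == 0) s
      & (\sum_i rdeg B' i <= \sum_i rdeg B i)%N].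
Proof.
elim: s q B => [|l s IH] q B fB; first by exists q, B; split=> // y; rewrite andbT.
have [q1 [B1 [fB1 B1E dB1]]] := coordinate_hyperplane l fB.
have [q2 [B2 [fB2 B2E dB2]]] := IH _ _ fB1; exists q2, B2; split=> // [y|].
  by rewrite B2E B1E -andbA.
exact: leq_trans dB2 dB1.
Qed.

Lemma truncated_subspace q m z (B : 'M[{poly F}]_(q, m + z)) :
    row_free (ratmx B) ->
  exists q' (Y : 'M[{poly F}]_(q', m)),
    [/\ row_free (ratmx Y),
        forall y : 'rV_m, (y <= ratmx Y)%MS = (row_mx y (0 : 'rV_z) <= ratmx B)%MS
      & (\sum_i rdeg Y i <= \sum_i rdeg B i)%N].
Proof.
move=> fB; pose s := [seq rshift m j | j <- enum 'I_z].
have [q' [B' [fB' B'E dB']]] := coordinate_subspace s fB.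
have B'r : rsubmx B' = 0.
  apply/matrixP=> i j; rewrite !mxE; have := B'E (row i (ratmx B')).
  rewrite row_sub => /esym/andP[_ /allP/(_ (rshift m j))].
  rewrite map_f ?mem_enum // => /(_ isT); rewrite !mxE tofrac_eq0.
  by move/eqP.
have B'eq : ratmx B' = row_mx (ratmx (lsubmx B')) 0.
  by rewrite -{1}[B']hsubmxK B'r /ratmx map_row_mx map_mx0.
exists q', (lsubmx B'); split.
- apply: inj_row_free => v vY; apply: (row_free_mul_eq0 fB').
  by rewrite B'eq mul_mx_row vY mulmx0 row_mx0.
- move=> y; transitivity (row_mx y (0 : 'rV_z) <= ratmx B')%MS.
    rewrite B'eq; apply/idP/idP => /submxP[w].
      by move=> ->; apply/submxP; exists w; rewrite mul_mx_row mulmx0.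
    by rewrite mul_mx_row mulmx0 => /eq_row_mx[-> _]; apply: submxMl.
  rewrite B'E [X in _ && X](_ : _ = true) ?andbT //.
  by apply/allP => _ /mapP[j _ ->]; rewrite row_mxEr mxE.
apply: leq_trans dB'; apply: leq_sum => i _; apply/rdeg_leP => j.
by rewrite mxE size_rdeg.
Qed.

End Euclid.

(** * Minimal indices of a subspace and of a matrix *)

Section Bridge.
Variable F : fieldType.
Local Notation K := (ratfun F).

Lemma eqmx_from_rows (L : fieldType) p q k (A : 'M[L]_(p, k)) (B : 'M_(q, k)) :
  (forall y : 'rV_k, (y <= A)%MS = (y <= B)%MS) -> (A :=: B)%MS.
Proof.
move=> AB; apply/eqmxP/andP; split; apply/row_subP => i.
  by rewrite -AB row_sub.
by rewrite AB row_sub.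
Qed.

Definition rows_of n k (b : n.-tuple 'cV[{poly F}]_k) : 'M[{poly F}]_(n, k) :=
  \matrix_(i < n) (tnth b i)^T.

Lemma rdeg_rows_of n k (b : n.-tuple 'cV[{poly F}]_k) i : rdeg (rows_of b) i = vdeg (tnth b i).
Proof. by rewrite /rdeg rowK trmxK. Qed.

Lemma sum_rdeg_rows_of n k (b : n.-tuple 'cV[{poly F}]_k) :
  (\sum_i rdeg (rows_of b) i = \sum_(v <- b) vdeg v)%N.
Proof. by rewrite big_tuple; apply: eq_bigr => i _; rewrite rdeg_rows_of. Qed.

Lemma row_rows_of n k (b : n.-tuple 'cV[{poly F}]_k) i :
  row i (ratmx (rows_of b)) = (ratmx (tnth b i))^T.
Proof. by rewrite -ratmx_row rowK /ratmx map_trmx. Qed.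

Lemma poly_basisP n k p (U : {vspace 'cV[K]_k}) (V : 'M[K]_(p, k))
    (b : n.-tuple 'cV[{poly F}]_k) :
    (forall y, (y \in U) = (y^T <= V)%MS) ->
  poly_basis U b <-> row_free (ratmx (rows_of b)) /\ (ratmx (rows_of b) :=: V)%MS.
Proof.
move=> UV; pose X := [tuple of [seq ratmx v | v <- b]].
have Xi (i : 'I_n) : X`_i = ratmx (tnth b i) by rewrite -tnth_nth tnth_map.
have comb (w : 'rV[K]_n) : \sum_i w ord0 i *: X`_i = (w *m ratmx (rows_of b))^T.
  rewrite mulmx_sum_row [RHS]raddf_sum; apply: eq_bigr => i _.
  by rewrite Xi -[in LHS](trmxK (ratmx _)) -row_rows_of; apply/matrixP => a c; rewrite !mxE.
have spanE y : (y \in <<X>>%VS) = (y^T <= ratmx (rows_of b))%MS.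
  apply/idP/idP => [/coord_span -> | /submxP[w yw]].
    pose w := \row_i coord X i y.
    rewrite (eq_bigr (fun i => w ord0 i *: X`_i)) => [|i _]; last by rewrite mxE.
    by rewrite comb trmxK submxMl.
  rewrite -[y]trmxK yw -comb; apply: memv_suml => i _; apply: memvZ.
  by rewrite memv_span // mem_nth // size_tuple.
have freeE : free X = row_free (ratmx (rows_of b)).
  apply/freeP/idP => [H|fB c].
    apply: inj_row_free => w wB; apply/rowP => i; rewrite mxE.
    by apply: (H (w ord0)); rewrite comb wB trmx0.
  pose w := \row_i c i.
  rewrite (eq_bigr (fun i => w ord0 i *: X`_i)) => [|i _]; last by rewrite mxE.
  rewrite comb => /(canRL trmxK); rewrite trmx0 => /(row_free_mul_eq0 fB)/rowP H i.
  by have := H i; rewrite !mxE.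
rewrite /poly_basis /basis_of -[map _ _]/(tval X) freeE; split.
  case/andP => /eqP sX fB; split=> //; apply: eqmx_from_rows => y.
  by rewrite -[y]trmxK -spanE -UV -sX.
case=> -> eqB; rewrite andbT; apply/eqP/vspaceP => y.
by rewrite spanE UV eqB.
Qed.

(** A minimal basis sorted by degree, as a matrix: row i then has degree
    [nth 0 ind i]. *)
Lemma minimal_indices_mx k p (U : {vspace 'cV[K]_k}) (V : 'M[K]_(p, k)) ind :
    (forall y, (y \in U) = (y^T <= V)%MS) -> minimal_indices U ind ->
  sorted geq ind /\ exists B : 'M[{poly F}]_(size ind, k),
    [/\ minimal_mx B, (ratmx B :=: V)%MS & forall i, rdeg B i = nth 0%N ind i].
Proof.
move=> UV [b0 [bas0 min0] ind_b0].
pose r := relpre (@vdeg F k) geq; pose b1 := sort r b0.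
have pb : perm_eq b1 b0 by rewrite perm_sort.
have ind_b : ind = [seq vdeg v | v <- b1] by rewrite ind_b0 /b1 sort_map.
split; first by rewrite ind_b0; apply: sort_sorted => x y; apply: leq_total.
have sz_b : size b1 == size ind by rewrite ind_b size_map.
pose b := Tuple sz_b; have bas : poly_basis U b.
  by rewrite /poly_basis (perm_basis _ (perm_map _ pb)).
have [fB eqB] := (poly_basisP b UV).1 bas.
have dB i : rdeg (rows_of b) i = nth 0%N ind i.
  have nth_ind j : (j < size ind)%N -> nth 0%N ind j = vdeg b1`_j.
    by rewrite {}ind_b size_map => lt_j; rewrite (nth_map 0).
  by rewrite rdeg_rows_of (tnth_nth 0) nth_ind.
have minB : least_degree (rows_of b).
  move=> B' fB' eqB'; pose b' := [tuple (row i B')^T | i < size ind].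
  have rB' : rows_of b' = B' by apply/row_matrixP => i; rewrite rowK tnth_mktuple trmxK.
  have bas' : poly_basis U b'.
    by apply/(poly_basisP b' UV); rewrite rB' fB'; split=> // *; apply: eqmx_trans eqB.
  have := min0 _ bas'; rewrite -(perm_big _ pb) /=.
  by rewrite -[b1]/(tval b) -[B' in X in _ -> X]rB' !sum_rdeg_rows_of.
exists (rows_of b); split=> //; split; first exact: least_degree_primitive.
exact: least_degree_reduced.
Qed.

Lemma mx_minimal_indices k p (U : {vspace 'cV[K]_k}) (V : 'M[K]_(p, k)) ind
    (B : 'M[{poly F}]_(size ind, k)) :
    (forall y, (y \in U) = (y^T <= V)%MS) -> sorted geq ind ->
    minimal_mx B -> (ratmx B :=: V)%MS -> (forall i, rdeg B i = nth 0%N ind i) ->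
  minimal_indices U ind.
Proof.
move=> UV s_ind minB eqB dB; pose b := [tuple (row i B)^T | i < size ind].
have rB : rows_of b = B by apply/row_matrixP => i; rewrite rowK tnth_mktuple trmxK.
have fB := minimal_row_free minB.
have bas : poly_basis U b by apply/(poly_basisP b UV); rewrite rB.
have ind_b : ind = [seq vdeg v | v <- b].
  apply: (@eq_from_nth _ 0%N) => [|i lt_i]; first by rewrite size_map size_tuple.
  rewrite (nth_map 0) ?size_tuple // -(tnth_nth 0 b (Ordinal lt_i)) -rdeg_rows_of rB dB //.
exists b; last by rewrite -ind_b sorted_sort //; move=> x y z /= xy yz; apply: leq_trans yz xy.
split=> // b' bas'.
have sz' : size b' == size ind.
  have := size_basis (X := in_tuple _) bas'.
  have := size_basis (X := [tuple of [seq ratmx v | v <- b]]) bas.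
  by rewrite size_map => -> ->.
have [fB' eqB'] := (poly_basisP (Tuple sz') UV).1 bas'.
have := minimal_least_degree minB fB' (eqmx_trans eqB' (eqmx_sym eqB)).
by rewrite -{1}rB !sum_rdeg_rows_of.
Qed.

End Bridge.

(** * Indices of a subspace against those of the ambient space *)

Lemma card_ord_geq n a : #|[set i : 'I_n | (a <= i)%N]| = (n - a)%N.
Proof.
rewrite cardsE -sum1_card; transitivity (\sum_(a <= i < n) 1)%N.
  by rewrite big_geq_mkord; apply: eq_bigl.
by rewrite sum_nat_const_nat muln1.
Qed.

Lemma sumn_drop_le a b s : (a <= b)%N -> (sumn (drop b s) <= sumn (drop a s))%N.
Proof.
move=> le_ab; rewrite -(subnK le_ab) -drop_drop.
by rewrite -{2}(cat_take_drop (b - a) (drop a s)) sumn_cat leq_addl.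
Qed.

Section Necessity.
Variable F : fieldType.
Local Notation K := (ratfun F).

Lemma degreesE k (e : seq nat) (B : 'M[{poly F}]_(size e, k)) :
  (forall i, rdeg B i = nth 0%N e i) -> degrees B = e.
Proof.
move=> dB; apply: (@eq_from_nth _ 0%N) => [|i]; rewrite size_degrees // => lt_i.
by rewrite -[i]/(nat_of_ord (Ordinal lt_i)) nth_degrees dB.
Qed.

Lemma sum_rdeg_geq k (e : seq nat) (B : 'M[{poly F}]_(size e, k)) h :
  (forall i, rdeg B i = nth 0%N e i) ->
  (\sum_(i in [set i : 'I_(size e) | h <= i]) rdeg B i = sumn (drop h e))%N.
Proof.
move=> dB; rewrite sumn_drop big_geq_mkord; apply: eq_big => i; first by rewrite inE.
by rewrite dB.
Qed.

(** Below the gap the rows of D lie in the span of those of C.  There are equally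
    many, so the spans are equal, and comparing indices in both directions gives
    equality. *)
Lemma subspace_tail k x h (c d : seq nat) (C : 'M[{poly F}]_(size c, k)) (D : 'M_(size d, k)) :
    sorted geq c -> sorted geq d ->
    minimal_mx C -> minimal_mx D ->
    (forall i, rdeg C i = nth 0%N c i) -> (forall i, rdeg D i = nth 0%N d i) ->
    (ratmx D <= ratmx C)%MS -> size c = (size d + x)%N -> (x <= h)%N ->
    (forall i j, (h - x <= i < size d)%N -> (j < h)%N -> (nth 0%N d i < nth 0%N c j)%N) ->
  drop (h - x) d = drop h c.
Proof.
move=> sc sd mC mD dC dD sDC szc le_xh gap.
set A := [set j : 'I_(size c) | (h <= j)%N].
set A' := [set i : 'I_(size d) | (h - x <= i)%N].
have sA : (subrows A' (ratmx D) <= subrows A (ratmx C))%MS.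
  apply: low_degree_sub => // i j; rewrite !inE -ltnNge => iA jA.
  by rewrite dC dD gap // iA ltn_ord.
have {}sA : (subrows A (ratmx C) <= subrows A' (ratmx D))%MS.
  rewrite -(mxrank_leqif_sup sA) (eqP (subrows_free _ (minimal_row_free mC))).
  rewrite (eqP (subrows_free _ (minimal_row_free mD))) !card_ord_geq szc.
  by apply/eqP; lia.
apply: (@eq_from_nth _ 0%N) => [|i0]; rewrite !size_drop ?szc; first by lia.
rewrite ltn_subRL !nth_drop; set i := (h - x + i0)%N => lt_i.
have -> : (h + i0 = i + x)%N by rewrite /i; lia.
apply/eqP; rewrite eqn_leq; apply/andP; split; last first.
  have -> : x = (size c - size d)%N by rewrite szc addKn.
  apply: dominated_nth => // [|T]; first by rewrite szc leq_addr.
  rewrite -{1}(degreesE dC) -{1}(degreesE dD).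
  by apply: count_degrees_sub => //; apply: minimal_row_free.
rewrite leqNgt; apply/negP => lt_cd.
pose A1 := [set j : 'I_(size c) | (i + x <= j)%N].
pose A2 := [set l : 'I_(size d) | (i.+1 <= l)%N].
have : (#|[set: 'I_#|A1|]| <= #|A2|)%N.
  apply: (low_degree_card (B' := subrows A1 C) mD).
  - by rewrite ratmx_subrows subrows_free // minimal_row_free.
  - rewrite ratmx_subrows; apply/row_subP => a; rewrite row_rowsub.
    have aA : enum_val a \in A by have := enum_valP a; rewrite !inE /i; lia.
    apply: submx_trans (row_sub_subrows _ aA) _; apply: submx_trans sA _.
    by apply/row_subP => b; rewrite row_rowsub row_sub.
  move=> a l _; rewrite !inE -ltnNge ltnS => le_l; rewrite rdeg_subrows dC dD.
  have := enum_valP a; rewrite inE => le_a.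
  apply: leq_ltn_trans (leq_trans lt_cd _); apply: sorted_geq_nth => //.
rewrite cardsT card_ord !card_ord_geq szc; lia.
Qed.

Lemma rdeg_row_mx0 q m z (Y : 'M[{poly F}]_(q, m)) i :
  rdeg (row_mx Y (0 : 'M_(q, z))) i = rdeg Y i.
Proof.
apply/eqP; rewrite eqn_leq; apply/andP; split; apply/rdeg_leP => j.
  by case: (split_ordP j) => l ->; rewrite ?row_mxEl ?row_mxEr ?size_rdeg // mxE size_poly0.
by have := size_rdeg (row_mx Y (0 : 'M_(q, z))) i (lshift z j); rewrite row_mxEl.
Qed.

Lemma ratmx_row_mx0 q m z (Y : 'M[{poly F}]_(q, m)) :
  ratmx (row_mx Y (0 : 'M_(q, z))) = row_mx (ratmx Y) 0.
Proof. by rewrite /ratmx map_row_mx map_mx0. Qed.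

Lemma row_mx0_free q m z (A : 'M[K]_(q, m)) : row_free A -> row_free (row_mx A (0 : 'M_(q, z))).
Proof.
move=> fA; apply: inj_row_free => v; rewrite mul_mx_row mulmx0 => vA0.
by apply: (row_free_mul_eq0 fA); have := congr1 lsubmx vA0; rewrite row_mxKl linear0.
Qed.

(** Y' is a basis of a subspace of vectors of length m + z, and Y one of the
    subspace where the last z coordinates vanish. *)
Section Restriction.
Variables (m z : nat) (u v : seq nat).
Variables (Y : 'M[{poly F}]_(size u, m)) (Y' : 'M[{poly F}]_(size v, m + z)).
Hypotheses (mY : minimal_mx Y) (mY' : minimal_mx Y').
Hypotheses (dY : forall i, rdeg Y i = nth 0%N u i) (dY' : forall i, rdeg Y' i = nth 0%N v i).
Hypothesis restr : forall y : 'rV_m, (y <= ratmx Y)%MS = (row_mx y (0 : 'rV_z) <= ratmx Y')%MS.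

Let Y0 := row_mx Y (0 : 'M_(size u, z)).

Lemma row_pad i : row i (ratmx Y0) = row_mx (row i (ratmx Y)) 0.
Proof. by rewrite ratmx_row_mx0 row_row_mx row0. Qed.

Lemma sub_pad : (ratmx Y0 <= ratmx Y')%MS.
Proof. by apply/row_subP => i; rewrite row_pad -restr row_sub. Qed.

Lemma free_pad : row_free (ratmx Y0).
Proof. by rewrite ratmx_row_mx0 row_mx0_free // minimal_row_free. Qed.

Lemma restriction_nth i : sorted geq u -> sorted geq v -> (size u <= size v)%N -> (i < size u)%N ->
  (nth 0%N v (i + (size v - size u)) <= nth 0%N u i)%N.
Proof.
move=> su sv le_uv; apply: dominated_nth => // T.
have dY0 : degrees Y0 = u by apply: degreesE => a; rewrite rdeg_row_mx0.
rewrite -{1}dY0 -(degreesE dY').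
exact: count_degrees_sub mY' free_pad sub_pad.
Qed.

(** The rows of Y' from h on span a subspace whose intersection with the
    coordinate subspace has degree at most [sumn (drop h v)].  By the gap this
    intersection contains the rows of Y from a on; being contained in the span of
    Y, it has degree at least that of the same number of last indices of Y. *)
Lemma restriction_tail a h : sorted geq u ->
    (forall i j, (a <= i < size u)%N -> (j < h)%N -> (nth 0%N u i < nth 0%N v j)%N) ->
  (sumn (drop a u) <= sumn (drop h v))%N.
Proof.
move=> su gap; pose A := [set l : 'I_(size v) | (h <= l)%N].
pose A' := [set i : 'I_(size u) | (a <= i)%N].
have fY' := minimal_row_free mY'.
have [|q' [Y1 [fY1 Y1E dY1]]] := @truncated_subspace F #|A| m z (subrows A Y').
  by rewrite ratmx_subrows subrows_free.
have sA : (subrows A' (ratmx Y0) <= subrows A (ratmx Y'))%MS.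
  apply: low_degree_sub mY' sub_pad _ => i j; rewrite !inE -ltnNge => iA jA.
  by rewrite rdeg_row_mx0 dY dY' gap ?iA ?ltn_ord.
have sA1 : (subrows A' (ratmx Y) <= ratmx Y1)%MS.
  apply/row_subP => i; rewrite row_rowsub Y1E ratmx_subrows -row_pad.
  exact: submx_trans (row_sub_subrows _ (enum_valP i)) sA.
have sY1 : (ratmx Y1 <= ratmx Y)%MS.
  apply/row_subP => i; rewrite restr; have := row_sub i (ratmx Y1).
  rewrite Y1E => /submx_trans; apply.
  by rewrite ratmx_subrows; apply/row_subP => b; rewrite row_rowsub row_sub.
have le_q : (size u - a <= q')%N.
  have := mxrankS sA1; rewrite (eqP (subrows_free _ (minimal_row_free mY))) card_ord_geq.
  by rewrite (eqP fY1).
have ge_q : (q' <= size u)%N.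
  by have := mxrankS sY1; rewrite (eqP fY1) (eqP (minimal_row_free mY)).
have := @dominated_sumn u (degrees Y1) su; rewrite size_degrees => /(_ ge_q) H.
apply: (@leq_trans (sumn (drop (size u - q') u))); first by apply: sumn_drop_le; lia.
apply: leq_trans (H _) _ => [T|].
  by rewrite -{1}(degreesE dY) count_degrees_sub.
rewrite sumn_degrees (leq_trans dY1) // sum_rdeg_subrows sum_rdeg_geq //.
Qed.

End Restriction.
End Necessity.

(** * Subspaces with prescribed minimal indices *)

Section Subspaces.
Variable F : fieldType.
Local Notation K := (ratfun F).

Lemma colsub_row_free (L : fieldType) q q' k (g : 'I_k -> 'I_q') (A : 'M[L]_(q, q')) :
  row_free (colsub g A) -> row_free A.
Proof.
move=> fA; apply: inj_row_free => v vA; apply: (row_free_mul_eq0 fA).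
by rewrite mulmx_colsub vA; apply/matrixP => i j; rewrite !mxE.
Qed.

Lemma unitriangular_unitmx (R : comUnitRingType) n (A : 'M[R]_n) :
  (forall i, A i i = 1) -> (forall i j : 'I_n, (i < j)%N -> A i j = 0) -> A \in unitmx.
Proof.
move=> A1 A0; rewrite unitmxE det_trig; last first.
  by apply/is_trig_mxP => i j; apply: A0.
by rewrite big1 ?unitr1.
Qed.

(** The unimodular block of P recovers polynomial coordinates with respect to
    P B from those with respect to B. *)
Lemma primitive_mul q q' k (B : 'M[{poly F}]_(q, k)) (P : 'M[{poly F}]_(q', q))
    (f : 'I_q' -> 'I_q) :
    primitive B -> row_free (ratmx B) -> colsub f P \in unitmx -> primitive (P *m B).
Proof.
move=> pB fB uP y /submxP[w]; rewrite ratmxM mulmxA => yw.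
have [p yp] : exists p, y = p *m B by apply: pB; rewrite yw submxMl.
have pw : ratmx p = w *m ratmx P.
  by apply: (row_free_inj fB); rewrite -yw yp ratmxM.
exists (colsub f p *m invmx (colsub f P)).
rewrite yp mulmxA; congr (_ *m B); apply: ratmx_inj; rewrite pw !ratmxM; congr (_ *m _).
apply/esym; have -> : ratmx (colsub f p) = w *m ratmx (colsub f P).
  apply/matrixP => i j; have /matrixP/(_ i (f j)) := pw; rewrite !mxE => ->.
  by apply: eq_bigr => l _; rewrite !mxE.
by rewrite -mulmxA -ratmxM mulmxV // /ratmx map_mx1 mulmx1.
Qed.

(** The leading matrix of P B at the degrees e is the product of the matrix of
    extreme coefficients of P by the leading matrix of B. *)
Lemma combine_minimal q q' k (B : 'M[{poly F}]_(q, k)) (P : 'M[{poly F}]_(q', q))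
    (f : 'I_q' -> 'I_q) (e : 'I_q' -> nat) :
    minimal_mx B -> colsub f P \in unitmx ->
    (forall i l, P i l != 0 -> (size (P i l) + rdeg B l <= (e i).+1)%N) ->
    row_free (\matrix_(i, l) (P i l)`_(e i - rdeg B l)) ->
  minimal_mx (P *m B) /\ forall i, rdeg (P *m B) i = e i.
Proof.
move=> mB uP dP; set Q := \matrix_(i, l) _ => fQ.
have [pB rB] := mB; have fB := minimal_row_free mB.
have le_e i l : P i l != 0 -> (rdeg B l <= e i)%N.
  move=> nz; rewrite -ltnS; apply: leq_trans (dP i l nz).
  by rewrite -add1n leq_add2r size_poly_gt0.
apply: minimal_mxI => [i j||]; last exact: primitive_mul pB fB uP.
  rewrite mxE; apply: (leq_trans (size_sum _ _ _)); apply/bigmax_leqP => l _.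
  have [->|nz] := eqVneq (P i l) 0; first by rewrite mul0r size_poly0.
  apply: (leq_trans (size_polyMleq _ _)); apply: leq_trans (dP i l nz).
  by rewrite -subn1 leq_subLR add1n -addnS leq_add2l size_rdeg.
have -> : leadmx e (P *m B) = Q *m leadmx (rdeg B) B.
  apply/matrixP => i j; rewrite !mxE coef_sum; apply: eq_bigr => l _; rewrite !mxE.
  have [->|nz] := eqVneq (P i l) 0; first by rewrite mul0r !coef0 mul0r.
  rewrite -coefM_top ?size_rdeg ?subnK ?le_e //.
  by rewrite -(leq_add2r (rdeg B l)) addSn subnK ?le_e // dP.
by rewrite /row_free mxrankMfree.
Qed.

Lemma subspace_exists k x h (c d : seq nat) (C : 'M[{poly F}]_(size c, k)) :
    sorted geq c -> minimal_mx C -> (forall i, rdeg C i = nth 0%N c i) ->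
    size c = (size d + x)%N -> (x <= h)%N ->
    (forall i, (i + x < h)%N -> (0 < x)%N && (nth 0%N c (i + x).-1 <= nth 0%N d i)%N) ->
    drop (h - x) d = drop h c ->
  exists D : 'M[{poly F}]_(size d, k),
    [/\ minimal_mx D, forall i, rdeg D i = nth 0%N d i & (ratmx D <= ratmx C)%MS].
Proof.
move=> sc mC dC szc le_xh head_d tail_d.
have tail i : (h <= i + x)%N -> nth 0%N d i = nth 0%N c (i + x).
  move=> le; have := congr1 (nth 0%N ^~ (i - (h - x))%N) tail_d.
  by rewrite /= !nth_drop => E; move: E; congr (nth _ _ _ = nth _ _ _); lia.
have lt_f (i : 'I_(size d)) : (i + x < size c)%N by rewrite szc ltn_add2r.
have lt_g (i : 'I_(size d)) : (i + x - (i + x < h) < size c)%N.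
  exact: leq_ltn_trans (leq_subr _ _) (lt_f i).
pose f i := Ordinal (lt_f i); pose g i := Ordinal (lt_g i).
(* P is bidiagonal.  Its entries 1 form a unitriangular block on the columns
   i + x, which makes P C primitive.  At the degrees d the extreme coefficients
   are unitriangular on the columns g, namely i + x - 1 before the gap, where the
   power of X carries the degree, and i + x after it. *)
pose P : 'M[{poly F}]_(size d, size c) := \matrix_(i, l)
  if l == (i + x)%N :> nat then 1
  else if (i + x < h)%N && (l.+1 == i + x)%N then 'X^(nth 0%N d i - nth 0%N c l) else 0.
exists (P *m C).
suff [mD dD] : minimal_mx (P *m C) /\ forall i, rdeg (P *m C) i = nth 0%N d i.
  by split=> //; rewrite ratmxM submxMl.
apply: (combine_minimal (f := f)) => //.
- apply: unitriangular_unitmx => [i|i j lt_ij]; rewrite !mxE /= ?eqxx //.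
  case: eqP => [|_]; first by lia.
  by case: eqP => [|_]; [lia | rewrite andbF].
- move=> i l; rewrite mxE dC.
  case: ifP => [/eqP-> _|_].
    rewrite size_poly1 add1n ltnS.
    have [le|/head_d/andP[x0]] := leqP h (i + x)%N; first by rewrite tail.
    by apply: leq_trans; apply: sorted_geq_nth => //; apply: leq_pred.
  case: ifP => [/andP[/head_d/andP[x0 le] /eqP e] _|_]; last by rewrite eqxx.
  by rewrite size_polyXn addSn subnK // -[l in nth _ _ l]/(l.+1.-1) e.
apply: (@colsub_row_free _ _ _ _ g); rewrite row_free_unit -unitmx_tr.
apply: unitriangular_unitmx => [i|i j lt_ij]; rewrite !mxE dC /=.
  have [lt|le] := ltnP (i + x)%N h.
    have /andP[x0 _] := head_d _ lt; rewrite subn1.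
    by rewrite ltn_eqF ?prednK ?eqxx ?ltn_predL ?addn_gt0 ?x0 ?orbT //= coefXn eqxx.
  by rewrite subn0 eqxx tail // subnn coef1.
have le_g : (i + x - (i + x < h) <= i + x)%N := leq_subr _ _.
case: eqP => [|_]; first by lia.
case: ifP => [/andP[lt /eqP eq_j]|_]; last by rewrite coef0.
have lt_i : (i + x < h)%N by lia.
by have /andP[x0 _] := head_d _ lt_i; move: eq_j; rewrite lt_i; lia.
Qed.

End Subspaces.

(** * Adding one row from the row space *)

Lemma row_free_col_mx (L : fieldType) q k (A : 'M[L]_(q, k)) (y : 'rV_k) :
  row_free A -> ~~ (y <= A)%MS -> row_free (col_mx A y).
Proof.
move=> fA yA; apply: inj_row_free => v; rewrite -[v]hsubmxK mul_row_col => e.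
have r0 : rsubmx v = 0.
  apply/eqP; apply: contraR yA => r_neq0.
  have {}r_neq0 : rsubmx v 0 0 != 0.
    by apply: contraNneq r_neq0 => r0; apply/eqP/matrixP => i j; rewrite !ord1 r0 mxE.
  rewrite -(eqmx_scale _ r_neq0) -mul_scalar_mx -mx11_scalar.
  by rewrite -(addKr (lsubmx v *m A) (_ *m y)) e addr0 eqmx_opp submxMl.
move: e; rewrite r0 mul0mx addr0 => /(row_free_mul_eq0 fA) ->.
by rewrite row_mx0.
Qed.

Lemma exists_row_outside (L : fieldType) q k (A : 'M[L]_(q, k)) : (q < k)%N ->
  exists y : 'rV_k, ~~ (y <= A)%MS.
Proof.
move=> lt_qk; have /row_subPn[i iA] : ~~ (1%:M <= A)%MS.
  apply/negP => /mxrankS; rewrite mxrank1 leqNgt => /negP[].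
  exact: leq_ltn_trans (rank_leq_row A) lt_qk.
by exists (row i 1%:M).
Qed.

Section AddRow.
Variable F : fieldType.
Local Notation K := (ratfun F).

Lemma primitive_refine q q' k (B : 'M[{poly F}]_(q, k)) (B' : 'M[{poly F}]_(q', k)) T :
  primitive B -> B = T *m B' -> (ratmx B' <= ratmx B)%MS -> primitive B'.
Proof.
move=> pB BT sB' y yB'; have [p ->] := pB y (submx_trans yB' sB').
by exists (p *m T); rewrite -mulmxA -BT.
Qed.

Lemma primitive_pad q m (Y : 'M[{poly F}]_(q, m)) (x : 'rV_m) :
  primitive Y -> primitive (col_mx (row_mx Y (0 : 'cV_q)) (row_mx x 1%:M)).
Proof.
move=> pY y /submxP[w]; rewrite /ratmx map_col_mx !map_row_mx map_mx0 map_mx1 -!/(ratmx _).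
rewrite -[w]hsubmxK mul_row_col !mul_mx_row mulmx0 mulmx1 add_row_mx add0r => yE.
have yr : ratmx (rsubmx y) = rsubmx w by rewrite /ratmx map_rsubmx -/(ratmx y) yE row_mxKr.
have [|p pE] := pY (lsubmx y - rsubmx y *m x).
  rewrite /ratmx map_mxB map_lsubmx -!/(ratmx _) ratmxM yr yE row_mxKl addrK.
  exact: submxMl.
exists (row_mx p (rsubmx y)); rewrite mul_row_col !mul_mx_row mulmx0 mulmx1 add_row_mx add0r.
by rewrite -pE subrK hsubmxK.
Qed.

Lemma size_XnM (p : {poly F}) a N : (size ('X^a * p)%R <= (a + N).+1)%N -> (size p <= N.+1)%N.
Proof.
have [->|p0] := eqVneq p 0; first by rewrite size_poly0.
by rewrite mulrC size_mulXn // -addnS leq_add2l.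
Qed.

(** The indices w arise from u by inserting an entry at position eta and lowering
    the entries before it by [a i], in total by A.  The kernel of R, with minimal
    basis Y, is to be enlarged by a vector (x, 1), where x is [new_row] and -x R
    is the row added to R.  Instead of the rows Y_i with i < eta and of (x, 1),
    the lattice has the basis g_0 = (x, 1), g_(i+1) = Y_i + X^(a i) g_i, of which
    g_i should have degree w_i.  The last member is
    g_eta = Z + X^A (x, 1), where Z only depends on Y.  Removing from x the
    quotient of Z by X^A leaves a remainder of degree less than A, and adding to
    x the vector X^s xi brings the degree to A + s = w_eta, with leading
    coefficients xi outside the leading rows of Y.  Then
    X^(a i) g_i = g_(i+1) - Y_i gives the other degrees and leading rows, from
    the last to the first. *)
Section Construction.
Variables (m : nat) (u w : seq nat) (eta s : nat).
Variable Y : 'M[{poly F}]_(size u, m).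
Hypotheses (mY : minimal_mx Y) (dY : forall i, rdeg Y i = nth 0%N u i).
Hypotheses (sw : sorted geq w) (size_w : size w = (size u).+1).
Hypothesis le_eta : (eta <= size u)%N.
Hypothesis head_w : forall i, (i < eta)%N -> (nth 0%N w i <= nth 0%N u i)%N.
Hypothesis tail_w : forall i, (eta <= i < size u)%N -> nth 0%N w i.+1 = nth 0%N u i.
Local Notation a i := (nth 0%N u i - nth 0%N w i)%N.
Hypothesis room : (\sum_(i < eta) a i + s = nth 0%N w eta)%N.

Definition padded_row (i : nat) : 'rV[{poly F}]_(m + 1) :=
  if insub i is Some i' then row_mx (row i' Y) 0 else 0.

Lemma padded_rowE (i : 'I_(size u)) : padded_row i = row_mx (row i Y) 0.
Proof. by rewrite /padded_row valK. Qed.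

Lemma size_padded_row i j : (size (padded_row i ord0 j) <= (nth 0%N u i).+1)%N.
Proof.
rewrite /padded_row; case: insubP => [i' _ <-|_]; last by rewrite mxE size_poly0.
have := size_rdeg (row_mx (row i' Y) (0 : 'rV_1)) ord0 j.
by rewrite rdeg_row_mx0 rdeg_row dY.
Qed.

(** The rows g_i of the construction, for an arbitrary first row, so that the part
    Z above is [chain 0 eta]. *)
Fixpoint chain (g0 : 'rV[{poly F}]_(m + 1)) (i : nat) : 'rV[{poly F}]_(m + 1) :=
  if i is i'.+1 then padded_row i' + 'X^(a i') *: chain g0 i' else g0.

Lemma chain_linear g0 i :
  chain g0 i = chain 0 i + 'X^(\sum_(j < i) a j) *: g0.
Proof.
elim: i => [|i IH] /=; first by rewrite big_ord0 expr0 scale1r add0r.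
rewrite IH scalerDr addrA scalerA -exprD big_ord_recr /=.
by congr (_ + 'X^_ *: _); rewrite addnC.
Qed.

Lemma chain0_rsubmx i : rsubmx (chain 0 i) = 0.
Proof.
elim: i => [|i IH] /=; first by rewrite linear0.
rewrite linearD linearZ /= IH scaler0 addr0 /padded_row.
by case: insubP => [i' _ _|_]; rewrite ?row_mxKr ?linear0.
Qed.

Variable xi : 'rV[F]_m.
Hypothesis xi_out : ~~ (xi <= leadmx (rdeg Y) Y)%MS.

Let A := (\sum_(i < eta) a i)%N.

Definition new_row : 'rV[{poly F}]_m :=
  'X^s *: map_mx polyC xi - map_mx (fun p => p %/ 'X^A) (lsubmx (chain 0 eta)).

Let g := chain (row_mx new_row 1%:M).

Lemma chain_top : g eta =
  row_mx (map_mx (fun p => p %% 'X^A) (lsubmx (chain 0 eta))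
          + 'X^(A + s) *: map_mx polyC xi) ('X^A)%:M.
Proof.
rewrite /g chain_linear -/A -[chain 0 eta]hsubmxK chain0_rsubmx scale_row_mx add_row_mx add0r.
rewrite row_mxKl scalemx1; congr (row_mx _ _).
rewrite /new_row scalerBr scalerA -exprD addrC -addrA [RHS]addrC; congr (_ + _).
by apply/rowP => j; rewrite !mxE {2}(divp_eq (chain 0 eta _ _) 'X^A) mulrC addKr.
Qed.

Lemma le_Aw : (A <= nth 0%N w eta)%N. Proof. by rewrite -room leq_addr. Qed.

Lemma size_modXA (p : {poly F}) : (size (p %% 'X^A)%R <= A)%N.
Proof. by rewrite -ltnS -(size_polyXn F A) ltn_modp -size_poly_eq0 size_polyXn. Qed.

Lemma size_chain_top j : (size (g eta ord0 j) <= (nth 0%N w eta).+1)%N.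
Proof.
rewrite chain_top; case: (split_ordP j) => l ->; rewrite ?row_mxEl ?row_mxEr !mxE.
  apply: (leq_trans (size_polyD _ _)); rewrite geq_max (leq_trans (size_modXA _)) ?(leqW le_Aw) //=.
  by rewrite mulrC mul_polyC (leq_trans (size_scale_leq _ _)) // size_polyXn room.
by rewrite !ord1 eqxx size_polyXn ltnS le_Aw.
Qed.

Lemma lead_chain_top (l : 'I_m) : (g eta ord0 (lshift 1 l))`_(nth 0%N w eta) = xi ord0 l.
Proof.
rewrite chain_top row_mxEl !mxE coefD nth_default ?add0r; last first.
  exact: leq_trans (size_modXA _) le_Aw.
by rewrite -room mulrC mul_polyC coefZ coefXn eqxx mulr1.
Qed.

Lemma size_chain i j : (i <= eta)%N -> (size (g i ord0 j) <= (nth 0%N w i).+1)%N.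
Proof.
move=> le_i; rewrite -(subKn le_i); move: (eta - i)%N => n.
elim: n => [|n IH]; first by rewrite subn0 size_chain_top.
have [le|lt] := leqP eta n; first by rewrite (_ : eta - n.+1 = eta - n)%N //; lia.
set b := (eta - n.+1)%N in IH *; have e : (eta - n = b.+1)%N by rewrite /b; lia.
have lt_b : (b < eta)%N by rewrite /b; lia.
rewrite e in IH.
apply: (@size_XnM _ (a b)); rewrite subnK ?head_w //.
have -> : 'X^(a b) * g b ord0 j = g b.+1 ord0 j - padded_row b ord0 j.
  by rewrite /g /= !mxE [RHS]addrC addKr.
apply: (leq_trans (size_polyD _ _)); rewrite size_polyN geq_max size_padded_row andbT.
apply: leq_trans IH _; rewrite ltnS (leq_trans _ (head_w lt_b)) //.
exact: sorted_geq_nth.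
Qed.

(** Read at degree u_i, the relation between consecutive rows of the chain places
    the leading row of Y_i in the span of the new leading rows. *)
Lemma lead_chain_step i j : (i < eta)%N ->
  (padded_row i ord0 j)`_(nth 0%N u i) =
    (nth 0%N w i.+1 == nth 0%N u i)%:R * (g i.+1 ord0 j)`_(nth 0%N w i.+1)
    - (g i ord0 j)`_(nth 0%N w i).
Proof.
move=> lt_i; have le_wu := head_w lt_i.
have -> : padded_row i ord0 j = g i.+1 ord0 j - 'X^(a i) * g i ord0 j.
  by rewrite /g /= !mxE addrK.
rewrite coefB coefXnM ltnNge leq_subr /= subKn //; congr (_ - _).
have [->|ne] := eqVneq; first by rewrite mul1r.
rewrite mul0r nth_default // (leq_trans (size_chain _ _)) //.
by rewrite ltn_neqAle ne (leq_trans _ le_wu) // sorted_geq_nth.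
Qed.

Definition extended_basis : 'M[{poly F}]_(size w, m + 1) :=
  \matrix_(i < size w) (if (i <= eta)%N then g i else padded_row i.-1).

Let Ytilde := col_mx (row_mx Y (0 : 'cV_(size u))) (row_mx new_row 1%:M).

Lemma row_Ytilde_l i : row (lshift 1 i) Ytilde = padded_row i.
Proof. by rewrite /Ytilde rowKu row_row_mx row0 padded_rowE. Qed.

Lemma row_Ytilde_r i : row (rshift (size u) i) Ytilde = g 0.
Proof. by rewrite /Ytilde rowKd row_id. Qed.

Lemma row_extended_le (i : 'I_(size w)) : (i <= eta)%N -> row i extended_basis = g i.
Proof. by move=> le; rewrite rowK le. Qed.

Lemma row_extended_gt (i : 'I_(size w)) : (eta < i)%N -> row i extended_basis = padded_row i.-1.
Proof. by move=> lt; rewrite rowK leqNgt lt. Qed.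

Lemma size_extended (i : 'I_(size w)) j :
  (size (extended_basis i j) <= (nth 0%N w i).+1)%N.
Proof.
have -> : extended_basis i j = row i extended_basis ord0 j by rewrite [RHS]mxE.
have [le|lt] := leqP i eta; first by rewrite row_extended_le // size_chain.
rewrite row_extended_gt //; case: i lt => [[|i] lt_i] //= lt.
rewrite tail_w ?size_padded_row // -ltnS lt /=.
by move: lt_i; rewrite size_w.
Qed.

(** The change of basis is polynomial in this direction too, so primitivity carries
    over. *)
Lemma extended_spans : exists T, Ytilde = T *m extended_basis.
Proof.
suff /fin_all_exists[t tE] : forall i, exists t, row i Ytilde = t *m extended_basis.
  exists (\matrix_i t i); apply/row_matrixP => i.
  by rewrite row_mul rowK tE.
move=> i; case: (split_ordP i) => l ->; last first.
  have lt0 : (0 < size w)%N by rewrite size_w.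
  exists (delta_mx 0 (Ordinal lt0)); rewrite -rowE row_extended_le //.
  exact: row_Ytilde_r.
have lt1 : (l.+1 < size w)%N by rewrite size_w ltnS.
rewrite row_Ytilde_l; have [le|lt] := leqP eta l.
  by exists (delta_mx 0 (Ordinal lt1)); rewrite -rowE row_extended_gt.
exists (delta_mx 0 (Ordinal lt1) - 'X^(a l) *: delta_mx 0 (Ordinal (ltnW lt1))).
rewrite mulmxBl -scalemxAl -!rowE !row_extended_le //=; last exact: ltnW.
by rewrite /g /= addrK.
Qed.

Lemma extended_sub : (ratmx extended_basis <= ratmx Ytilde)%MS.
Proof.
have pad_sub i : (ratmx (padded_row i) <= ratmx Ytilde)%MS.
  rewrite /padded_row; case: insubP => [i' _ _|_]; last by rewrite /ratmx map_mx0 sub0mx.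
  by rewrite -padded_rowE -row_Ytilde_l ratmx_row row_sub.
have chain_sub i : (ratmx (g i) <= ratmx Ytilde)%MS.
  elim: i => [|i IH]; first by rewrite -(row_Ytilde_r 0) ratmx_row row_sub.
  rewrite /g /= /ratmx map_mxD -!/(ratmx _) ratmxZ addmx_sub ?pad_sub //.
  exact: scalemx_sub.
apply/row_subP => i; rewrite -ratmx_row.
by have [le|lt] := leqP i eta; [rewrite row_extended_le | rewrite row_extended_gt].
Qed.

(** The new leading rows span those of Y and that of g_eta, which are independent;
    their number shows that they are free. *)
Lemma lead_extended_free : row_free (leadmx (fun i => nth 0%N w i) extended_basis).
Proof.
set L := leadmx _ _.
have row_L (i : 'I_(size w)) (y : 'rV_(m + 1)) : row i extended_basis = y ->
    (\row_j (y ord0 j)`_(nth 0%N w i) <= L)%MS.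
  by move=> <-; rewrite (_ : \row_j _ = row i L) ?row_sub //; apply/rowP => j; rewrite !mxE.
have lt_w i : (i <= size u)%N -> (i < size w)%N by rewrite size_w ltnS.
pose top : 'rV_(m + 1) := \row_j (g eta ord0 j)`_(nth 0%N w eta).
pose M := col_mx (row_mx (leadmx (rdeg Y) Y) (0 : 'cV_(size u))) top.
have chain_L i : (i <= eta)%N -> (\row_j (g i ord0 j)`_(nth 0%N w i) <= L)%MS.
  move=> le; apply: (row_L (Ordinal (lt_w i (leq_trans le le_eta)))).
  by rewrite row_extended_le.
have sML : (M <= L)%MS.
  rewrite col_mx_sub chain_L // andbT; apply/row_subP => i.
  have -> : row i (row_mx (leadmx (rdeg Y) Y) (0 : 'cV_(size u))) =
      \row_j (padded_row i ord0 j)`_(nth 0%N u i).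
    apply/rowP => j; rewrite padded_rowE !mxE; case: splitP => l _; rewrite !mxE ?dY //.
    by rewrite coef0.
  have [le|lt] := leqP eta i.
    rewrite -tail_w ?le ?ltn_ord //.
    apply: (row_L (Ordinal (lt_w i.+1 (ltn_ord i)))).
    by rewrite row_extended_gt.
  rewrite (_ : \row_j _ =
      (nth 0%N w i.+1 == nth 0%N u i)%:R *: (\row_j (g i.+1 ord0 j)`_(nth 0%N w i.+1))
      - \row_j (g i ord0 j)`_(nth 0%N w i)); last first.
    apply/rowP => j; rewrite mxE lead_chain_step //.
    by move: (g i.+1) (g i) => y1 y0; rewrite !mxE.
  by rewrite addmx_sub ?scalemx_sub ?eqmx_opp ?chain_L // ltnW.
have fM : row_free M.
  apply: (@colsub_row_free _ _ _ _ (lshift 1)).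
  rewrite (_ : colsub _ _ = col_mx (leadmx (rdeg Y) Y) xi) ?row_free_col_mx //; first by case: mY.
  apply/matrixP => i j; rewrite mxE; case: (split_ordP i) => l ->.
    by rewrite /M !col_mxEu row_mxEl.
  by rewrite /M !col_mxEd mxE lead_chain_top [l]ord1.
by rewrite -row_leq_rank (leq_trans _ (mxrankS sML)) // (eqP fM) size_w addn1.
Qed.

Lemma extended_minimal :
  [/\ minimal_mx extended_basis, forall i, rdeg extended_basis i = nth 0%N w i
    & (ratmx extended_basis :=: ratmx Ytilde)%MS].
Proof.
have [T YT] := extended_spans.
have pE : primitive extended_basis.
  by apply: primitive_refine YT extended_sub; apply: primitive_pad; case: mY.
have [mE dE] := minimal_mxI size_extended lead_extended_free pE.
split=> //; apply/eqmxP; rewrite extended_sub /=.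
by rewrite YT ratmxM submxMl.
Qed.

End Construction.
End AddRow.

(** * Splitting the majorization into single insertions *)

Section Insertion.
Local Open Scope nat_scope.
Implicit Types u v w : seq nat.

(** The condition u_(h - j + 1) < v_h on entries counted from 1, both sequences
    being extended by +oo on the left and by -oo on the right. *)
Definition overtakes u v j h : bool :=
  [&& j <= h, 0 < h, h <= size v & (size u <= h - j) || (nth 0 u (h - j) < nth 0 v h.-1)].

Definition first_overtake u v j h : Prop :=
  overtakes u v j h /\ forall i, overtakes u v j i -> h <= i.

(** The generalized majorization of v by u and (S, 0, ..., 0) with S >= 0.  The
    partial sums of the latter are all equal to S, the difference of the sums of
    v and u, so the inequality for j compares the tails of u and v. *)
Definition completable u v : Prop :=
  [/\ sumn u <= sumn v,
      forall i, i < size u -> nth 0 v (i + (size v - size u)) <= nth 0 u i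
    & forall j h, 1 <= j <= size v - size u -> first_overtake u v j h ->
        sumn (drop (h - j) u) <= sumn (drop h v)].

Lemma completable_eq u v : size u = size v -> completable u v -> u = v.
Proof.
move=> sz [le_uv + _]; rewrite sz subnn => le_vu.
have {le_vu} : forall i, nth 0 v i <= nth 0 u i.
  move=> i; have [lt|ge] := ltnP i (size v); last by rewrite nth_default.
  by have := le_vu i lt; rewrite addn0.
elim: u v sz le_uv => [|a u IH] [|b v] //= [sz] le_uv le_vu.
have le_ba := le_vu 0.
have le : sumn v <= sumn u.
  rewrite -[v]drop0 -[u]drop0 !sumn_drop sz !big_nat; apply: leq_sum => i _.
  exact: (le_vu i.+1).
have ab : a = b by move: le_ba => /=; lia.
by rewrite ab (IH v) //; [lia | move=> i; apply: (le_vu i.+1)].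
Qed.

Lemma sorted_geq_cons a s : sorted geq s -> nth 0 s 0 <= a -> sorted geq (a :: s).
Proof. by case: s => //= b s -> ->. Qed.

(** The entries are lowered starting from the last one, which keeps the sequence
    decreasing. *)
Lemma shrink_between u v K : size u = size v -> sorted geq u -> sorted geq v ->
    (forall i, nth 0 v i <= nth 0 u i) -> K + sumn v <= sumn u ->
  exists w, [/\ size w = size u, sorted geq w,
    forall i, nth 0 v i <= nth 0 w i <= nth 0 u i & sumn w + K = sumn u].
Proof.
elim: u v K => [|a u IH] [|b v] //= K.
  by move=> _ _ _ _; rewrite addn0 leqn0 => /eqP->; exists [::]; split=> // i; rewrite nth_nil.
case=> sz su sv le_vu le_K.
have le_vu' i : nth 0 v i <= nth 0 u i := le_vu i.+1.
have sv' := path_sorted sv; have su' := path_sorted su.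
have le_sum : sumn v <= sumn u.
  rewrite -[v]drop0 -[u]drop0 !sumn_drop sz !big_nat; apply: leq_sum => i _.
  exact: le_vu'.
have [le|gt] := leqP (K + sumn v) (sumn u).
  have [w [szw sw bw Kw]] := IH v K sz su' sv' le_vu' le.
  exists (a :: w); split=> //=; [by rewrite szw | | | by lia].
    apply: sorted_geq_cons sw _; have /andP[_ le0] := bw 0.
    exact: leq_trans le0 (@sorted_geq_nth (a :: u) 0 1 su isT).
  by case=> [|i] /=; [have /= -> := le_vu 0; rewrite leqnn | apply: bw].
exists ((a - (K + sumn v - sumn u)) :: v); split=> //=; first by rewrite sz.
- apply: sorted_geq_cons sv' _.
  by have /= := @sorted_geq_nth (b :: v) 0 1 sv isT; lia.
- by case=> [|i] /=; [lia | rewrite leqnn le_vu'].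
by lia.
Qed.

(** Insert into u the first entry of v that overtakes it, and let it lower the
    preceding entries towards those of v as much as its size permits.  If it is
    used up, the sum of w is that of u; otherwise w agrees with v up to the
    insertion, and the majorization for j = 1 bounds its tail.  Later positions
    of overtaking are unchanged, shifted by one in j. *)
Lemma completable_insert u v t : sorted geq u -> sorted geq v ->
    size v = size u + t.+1 -> completable u v ->
  exists w eta s,
    [/\ [/\ size w = (size u).+1, sorted geq w & eta <= size u],
        forall i, i < eta -> nth 0 w i <= nth 0 u i,
        forall i, eta <= i < size u -> nth 0 w i.+1 = nth 0 u i,
        \sum_(i < eta) (nth 0 u i - nth 0 w i) + s = nth 0 w eta
      & completable w v].
Proof.
move=> su sv szv [le_uv tail_uv majo].
have exh : exists h, overtakes u v 1 h.
  by exists (size u).+1; rewrite /overtakes subn1 leqnn szv /= andbT; lia.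
case: (ex_minnP exh) => h over_h min_h.
have first_h : first_overtake u v 1 h by split.
have /and4P[_ h_gt0 le_hv gap_h] := over_h.
have [eta h_eta] : exists eta, h = eta.+1 by exists h.-1; rewrite prednK.
have {gap_h} gap_h : (size u <= eta) || (nth 0 u eta < nth 0 v eta).
  by move: gap_h; rewrite h_eta subn1.
have le_eta : eta <= size u.
  rewrite -ltnS -h_eta; apply: min_h; rewrite /overtakes subn1 leqnn szv /= andbT; lia.
have le_vu i : i < eta -> nth 0 v i <= nth 0 u i.
  move=> lt; rewrite leqNgt; apply/negP => gt.
  have : h <= i.+1 by apply: min_h; rewrite /overtakes subn1 /= gt orbT andbT; lia.
  by rewrite h_eta; lia.
have sz_take : size (take eta u) = size (take eta v).
  by rewrite !size_take_min; lia.
have le_take i : nth 0 (take eta v) i <= nth 0 (take eta u) i.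
  have [lt|ge] := ltnP i eta; first by rewrite !nth_take // le_vu.
  by rewrite nth_default // size_take_min; lia.
pose D := sumn (take eta u) - sumn (take eta v).
pose K := minn (nth 0 v eta) D.
have le_sum : sumn (take eta v) <= sumn (take eta u).
  rewrite -[take eta v]drop0 -[take eta u]drop0 !sumn_drop sz_take !big_nat.
  by apply: leq_sum => i _; apply: le_take.
have le_K : K + sumn (take eta v) <= sumn (take eta u) by rewrite /K /D; lia.
have [ws [szw sws bws Kws]] :=
  shrink_between sz_take (take_sorted _ su) (take_sorted _ sv) le_take le_K.
have {}szw : size ws = eta by rewrite szw size_take_min; lia.
pose w := ws ++ nth 0 v eta :: drop eta u.
have size_w : size w = (size u).+1 by rewrite size_cat /= size_drop szw; lia.
have w_lt i : i < eta -> nth 0 v i <= nth 0 w i <= nth 0 u i.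
  by move=> lt; rewrite nth_cat szw lt; have := bws i; rewrite !nth_take.
have w_eq : nth 0 w eta = nth 0 v eta by rewrite nth_cat szw ltnn subnn.
have w_gt i : eta <= i -> nth 0 w i.+1 = nth 0 u i.
  by move=> le; rewrite nth_cat szw ltnNge (leqW le) subSn //= nth_drop subnKC.
have sorted_w : sorted geq w.
  apply: sorted_geqP => i; rewrite size_w ltnS => lt_i.
  have [lt|gt|e] := ltngtP i.+1 eta.
  - rewrite !nth_cat szw lt (ltnW lt); exact: sorted_geq_nth.
  - rewrite w_gt; last by lia.
    have [->|ne] := eqVneq i eta.
      by rewrite w_eq; case/orP: gap_h => [le|/ltnW//]; rewrite nth_default.
    have -> : i = i.-1.+1 by lia.
    by rewrite w_gt; [apply: sorted_geq_nth => //; lia | lia].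
  have := w_lt i; rewrite -e ltnSn => /(_ isT)/andP[le _].
  by rewrite e w_eq -e (leq_trans _ le) // sorted_geq_nth.
exists w, eta, (nth 0 v eta - K); split=> //.
- by move=> i /w_lt/andP[].
- by move=> i /andP[le _]; apply: w_gt.
- rewrite w_eq; have -> : \sum_(i < eta) (nth 0 u i - nth 0 w i) = K; last first.
    by rewrite subnKC // geq_minl.
  rewrite sumnB => [|i _]; last by have /andP[] := w_lt i (ltn_ord i).
  have sum_take s : eta <= size s -> \sum_(i < eta) nth 0 s i = sumn (take eta s).
    move=> le; rewrite -[take eta s]drop0 sumn_drop size_take_min (minn_idPl le) big_mkord.
    by apply: eq_bigr => i _; rewrite nth_take.
  rewrite !sum_take //; last by rewrite size_w leqW.
  by rewrite -{2}szw take_size_cat // -Kws addKn.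
have drop_w i : eta < i -> drop i w = drop i.-1 u.
  case: i => // i lt; rewrite drop_cat szw ltnNge (ltnW lt) /= subSn //=.
  by rewrite drop_drop subnK.
split.
- have sum_w : sumn w = sumn ws + (nth 0 v eta + sumn (drop eta u)) by rewrite sumn_cat.
  have sum_u : sumn u = sumn (take eta u) + sumn (drop eta u) by rewrite -sumn_cat cat_take_drop.
  have sum_v : sumn v = sumn (take eta v) + (nth 0 v eta + sumn (drop h v)).
    rewrite -{1}(cat_take_drop eta v) sumn_cat (drop_nth 0) ?h_eta //; lia.
  have := majo 1 h; rewrite szv addKn => /(_ isT first_h); rewrite {1}h_eta subn1 /=.
  by move: le_uv Kws; rewrite sum_w sum_v sum_u /K /D; lia.
- move=> i; rewrite size_w ltnS szv addnS subSS addKn => le_i.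
  have [lt|gt|e] := ltngtP i eta.
  + have /andP[le _] := w_lt i lt; apply: leq_trans le.
    by apply: sorted_geq_nth => //; apply: leq_addr.
  + have -> : i = i.-1.+1 by lia.
    rewrite w_gt; last by lia.
    have := tail_uv i.-1; rewrite szv addKn addSnnS; apply; lia.
  by rewrite e w_eq; apply: sorted_geq_nth => //; apply: leq_addr.
move=> j i; rewrite size_w szv addnS subSS addKn => /andP[j_gt0 le_jt] [over_i min_i].
have over_w n : overtakes w v j n -> h <= n - j.
  case/and4P=> le_jn n_gt0 _ gap; rewrite leqNgt; apply/negP => lt; move: gap.
  apply/negP; rewrite negb_or -ltnNge -leqNgt size_w; apply/andP; split; first by lia.
  apply: (@leq_trans (nth 0 v (n - j))); first by apply: sorted_geq_nth => //; lia.
  have [lt_eta|ge_eta] := ltnP (n - j) eta; first by have /andP[] := w_lt _ lt_eta.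
  by rewrite (_ : n - j = eta) ?w_eq //; lia.
have over_u n : overtakes u v j.+1 n -> h <= n - j.
  case/and4P=> le_jn n_gt0 le_n gap; apply: min_h; rewrite /overtakes -subnDA addn1.
  apply/and4P; split; try lia; case/orP: gap => [->//|lt]; apply/orP; right.
  by apply: leq_trans lt _; apply: sorted_geq_nth => //; lia.
have over_eq n : h <= n - j -> overtakes w v j n = overtakes u v j.+1 n.
  move=> le; rewrite /overtakes size_w; have e : n - j = (n - j.+1).+1 by lia.
  rewrite e w_gt ?ltnS; last by lia.
  by congr (_ && _); apply/idP/idP; lia.
have le_h := over_w i over_i.
rewrite drop_w; last by lia.
have -> : (i - j).-1 = i - j.+1 by lia.
apply: majo; first by rewrite szv addKn ltnS.
split; first by rewrite -over_eq.
by move=> n over_n; apply: min_i; rewrite over_eq // over_u.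
Qed.

End Insertion.

Lemma sub_kermx_tr (L : fieldType) p q n (A : 'M[L]_(p, n)) (B : 'M_(q, n)) :
  (A <= kermx B^T)%MS = (B <= kermx A^T)%MS.
Proof. by rewrite !sub_kermx -{1}[A]trmxK -trmx_mul trmx_eq0. Qed.

Lemma kermx_tr_eqmx (L : fieldType) m m' n (R : 'M[L]_(m, n)) (R' : 'M_(m', n)) :
  (R :=: R')%MS -> (kermx R^T :=: kermx R'^T)%MS.
Proof.
move=> eqR; apply: eqmx_from_rows => y.
by rewrite sub_kermx_tr [RHS]sub_kermx_tr eqR.
Qed.

(** * Completing a matrix by rows *)

(** The orthogonal Q of D contains the rows of R, and W spans a complement of R in
    it.  The conclusion is stated for any basis W of C to let denominators be
    cleared afterwards. *)
Lemma complementary_rows (L : fieldType) m n q x (R : 'M[L]_(m, n)) (D : 'M_(q, n)) :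
    row_free D -> (D <= kermx R^T)%MS -> (q + (\rank R + x) = n)%N ->
  exists2 C : 'M_n, \rank C = x & forall W : 'M_(x, n), (W :=: C)%MS ->
    [/\ row_free W, (R :&: W)%MS = 0, \rank (col_mx R W) = (\rank R + x)%N
      & (D :=: kermx (col_mx R W)^T)%MS].
Proof.
move=> fD sDR szD; pose Q := kermx D^T.
have rQ : \rank Q = (\rank R + x)%N by rewrite mxrank_ker mxrank_tr (eqP fD); lia.
have sRQ : (R <= Q)%MS by rewrite sub_kermx_tr.
have cRC : (R :&: (Q :\: R))%MS = 0.
  by apply/eqP; rewrite -submx0 capmxC capmx_diff sub0mx.
have eqRC : (R + (Q :\: R) :=: Q)%MS.
  apply/eqmxP; rewrite addsmx_sub sRQ diffmxSl /= -(addsmx_diff_cap_eq Q R) addsmxC.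
  by rewrite addsmxS ?capmxSr.
have rC : \rank (Q :\: R)%MS = x.
  by have := mxrank_disjoint_sum cRC; rewrite eqRC rQ => /addnI.
exists (Q :\: R)%MS => // W eqW.
have eqRW : (col_mx R W :=: Q)%MS.
  apply: eqmx_trans eqRC; apply: eqmx_trans (eqmx_sym (addsmxE _ _)) _.
  by apply: adds_eqmx.
split.
- by rewrite -row_leq_rank eqW rC.
- by apply/eqP; rewrite -submx0 -cRC; apply: capmxS; rewrite ?eqW.
- by rewrite eqRW.
have sD : (D <= kermx (col_mx R W)^T)%MS by rewrite sub_kermx_tr eqRW.
apply/eqmxP/andP; split=> //.
rewrite -(mxrank_leqif_sup sD) (eqP fD) mxrank_ker mxrank_tr eqRW rQ.
by apply/eqP; lia.
Qed.

Section Completion.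
Variable F : fieldType.
Local Notation K := (ratfun F).

(** Right kernels are covered by applying this to transposes. *)
Definition has_left_indices m n (R : 'M[K]_(m, n)) (u : seq nat) : Prop :=
  exists Y : 'M[{poly F}]_(size u, m),
    [/\ minimal_mx Y, (ratmx Y :=: kermx R)%MS & forall i, rdeg Y i = nth 0%N u i].

Lemma row_minimal_indicesP m n (R : 'M[K]_(m, n)) u :
  row_minimal_indices R u <-> sorted geq u /\ has_left_indices R u.
Proof.
have memU y : (y \in left_kernel R) = (y^T <= kermx R)%MS.
  by rewrite mem_left_kernel; apply/eqP/sub_kermxP.
split; first exact: minimal_indices_mx.
by case=> su [Y [mY eqY dY]]; apply: mx_minimal_indices memU su mY eqY dY.
Qed.

Lemma column_minimal_indicesP m n (R : 'M[K]_(m, n)) c :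
  column_minimal_indices R c <-> sorted geq c /\ has_left_indices R^T c.
Proof.
have memU y : (y \in right_kernel R) = (y^T <= kermx R^T)%MS.
  rewrite mem_right_kernel; apply/eqP/sub_kermxP => [e|]; first by rewrite -trmx_mul e trmx0.
  by rewrite -trmx_mul => /(canRL trmxK); rewrite trmx0.
split; first exact: minimal_indices_mx.
by case=> sc [C [mC eqC dC]]; apply: mx_minimal_indices memU sc mC eqC dC.
Qed.

Lemma has_left_indices_size m n (R : 'M[K]_(m, n)) u :
  has_left_indices R u -> size u = (m - \rank R)%N.
Proof.
by case=> Y [mY eqY _]; rewrite -mxrank_ker -eqY (eqP (minimal_row_free mY)).
Qed.

Lemma has_left_indices_cast m m' n (e : m = m') (R : 'M[K]_(m, n)) u :
  has_left_indices R u -> has_left_indices (castmx (e, erefl n) R) u.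
Proof. by case: m' / e; rewrite castmx_id. Qed.

Lemma has_right_indices_eqmx m m' n (R : 'M[K]_(m, n)) (R' : 'M_(m', n)) d :
  (R :=: R')%MS -> has_left_indices R^T d -> has_left_indices R'^T d.
Proof.
move=> eqR [D [mD eqD dD]]; exists D.
by split; [exact: mD | exact: eqmx_trans eqD (kermx_tr_eqmx eqR) | exact: dD].
Qed.

Lemma sub_row_mx0 p m z (A : 'M[K]_(p, m)) (y : 'rV_(m + z)) :
  (y <= row_mx A (0 : 'M_(p, z)))%MS = (lsubmx y <= A)%MS && (rsubmx y == 0).
Proof.
apply/idP/andP => [/submxP[w ->]|[/submxP[w yA] /eqP yr]].
  by rewrite mul_mx_row mulmx0 row_mxKl row_mxKr submxMl.
by rewrite -[y]hsubmxK yA yr; apply/submxP; exists w; rewrite mul_mx_row mulmx0.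
Qed.

Lemma minimal_row_mx0 q m z (Y : 'M[{poly F}]_(q, m)) :
  minimal_mx Y -> minimal_mx (row_mx Y (0 : 'M_(q, z))).
Proof.
move=> [pY rY]; apply: (proj1 (minimal_mxI (e := rdeg Y) _ _ _)).
- by move=> i j; rewrite -(rdeg_row_mx0 z Y) size_rdeg.
- apply: (@colsub_row_free _ _ _ _ (lshift z)).
  rewrite (_ : colsub _ _ = leadmx (rdeg Y) Y) //.
  by apply/matrixP => i j; rewrite 2!mxE row_mxEl [RHS]mxE.
move=> y; rewrite ratmx_row_mx0 sub_row_mx0 => /andP[yl /eqP yr].
have yr0 : rsubmx y = 0.
  by apply: ratmx_inj; rewrite /ratmx map_rsubmx -/(ratmx y) yr map_mx0.
have [|p pE] := pY (lsubmx y); first by rewrite /ratmx map_lsubmx.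
by exists p; rewrite mul_mx_row mulmx0 -pE -[LHS]hsubmxK yr0.
Qed.

(** A relation between the rows of R and W involves none of the rows of W. *)
Lemma has_left_indices_independent m z n (R : 'M[K]_(m, n)) (W : 'M_(z, n)) u :
    row_free W -> (R :&: W)%MS = 0 ->
  has_left_indices R u -> has_left_indices (col_mx R W) u.
Proof.
move=> fW RW [Y [mY eqY dY]]; exists (row_mx Y (0 : 'M_(size u, z))); split.
- exact: minimal_row_mx0.
- apply: eqmx_from_rows => y; rewrite ratmx_row_mx0 sub_row_mx0 eqY !sub_kermx.
  rewrite -{3}[y]hsubmxK mul_row_col.
  apply/andP/eqP => [[/eqP-> /eqP->]|e]; first by rewrite mul0mx addr0.
  have yW : rsubmx y *m W = 0.
    apply/eqP; rewrite -submx0 -RW sub_capmx submxMl andbT.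
    by rewrite -(addKr (lsubmx y *m R) (_ *m W)) e addr0 eqmx_opp submxMl.
  by move: e; rewrite yW addr0 => ->; rewrite (row_free_mul_eq0 fW yW) !eqxx.
by move=> i; rewrite rdeg_row_mx0.
Qed.

Lemma add_row m n (R : 'M[K]_(m, n)) (u w : seq nat) (eta s : nat) :
    (size u < m)%N -> size w = (size u).+1 -> sorted geq w -> (eta <= size u)%N ->
    (forall i, (i < eta)%N -> (nth 0%N w i <= nth 0%N u i)%N) ->
    (forall i, (eta <= i < size u)%N -> nth 0%N w i.+1 = nth 0%N u i) ->
    (\sum_(i < eta) (nth 0%N u i - nth 0%N w i) + s = nth 0%N w eta)%N ->
    has_left_indices R u ->
  exists x : 'rV[{poly F}]_m, has_left_indices (col_mx R (ratmx x *m R)) w.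
Proof.
move=> lt_um szw sw le_eta head_w tail_w room [Y [mY eqY dY]].
have [xi xi_out] := exists_row_outside (leadmx (rdeg Y) Y) lt_um.
have [mE dE eqE] := extended_minimal mY dY sw szw le_eta head_w tail_w room xi_out.
set x := new_row _ _ _ _ _ in eqE; exists (- x).
exists (extended_basis w eta s Y xi); split=> //.
apply: eqmx_from_rows => y; rewrite eqE sub_kermx -[in RHS](hsubmxK y) mul_row_col.
rewrite /ratmx map_col_mx !map_row_mx map_mx0 map_mx1 map_mxN -!/(ratmx _) mulmxA -mulmxDl.
rewrite mulmxN -sub_kermx -eqY; apply/submxP/idP => [[v]|/submxP[v vE]].
  rewrite -[v]hsubmxK mul_row_col !mul_mx_row mulmx0 mulmx1 add_row_mx add0r => ->.
  by rewrite row_mxKl row_mxKr addrK submxMl.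
exists (row_mx v (rsubmx y)).
rewrite mul_row_col !mul_mx_row mulmx0 mulmx1 add_row_mx add0r.
by rewrite -vE subrK hsubmxK.
Qed.

(** One row of the row space of R per inserted index; the rank does not change, so
    there remains room outside the left kernel at every step. *)
Lemma add_rows t m n (R : 'M[K]_(m, n)) (u v : seq nat) :
    (0 < \rank R)%N -> sorted geq u -> sorted geq v -> size v = (size u + t)%N ->
    completable u v -> has_left_indices R u ->
  exists X : 'M[{poly F}]_(t, m), has_left_indices (col_mx R (ratmx X *m R)) v.
Proof.
elim: t m R u => [|t IH] m R u rR su sv szv uv hR.
  exists 0; rewrite -(completable_eq _ uv); last by rewrite szv addn0.
  apply: has_left_indices_independent hR; last by rewrite [ratmx _ *m R]flatmx0 capmx0.
  by rewrite -row_leq_rank.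
have [w [eta [s [[szw sw le_eta] head_w tail_w room wv]]]] := completable_insert su sv szv uv.
have lt_um : (size u < m)%N.
  by rewrite (has_left_indices_size hR) ltn_subrL rR (leq_trans rR (rank_leq_row R)).
have [x hx] := add_row lt_um szw sw le_eta head_w tail_w room hR.
set R1 := col_mx R _ in hx.
have [||X hX] := IH _ R1 w _ sw sv _ wv hx.
- by apply: leq_trans rR _; apply: mxrankS; have := submx_refl R1; rewrite col_mx_sub => /andP[].
- by rewrite szv szw addnS addSn.
exists (col_mx x (lsubmx X + rsubmx X *m x)).
have -> : ratmx (col_mx x (lsubmx X + rsubmx X *m x)) *m R =
    col_mx (ratmx x *m R) (ratmx X *m R1).
  rewrite {1}/ratmx map_col_mx mul_col_mx -!/(ratmx _); congr (col_mx _ _).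
  rewrite /R1 -[X in RHS](hsubmxK X) {2}/ratmx map_row_mx mul_row_col -!/(ratmx _).
  by rewrite {1}/ratmx map_mxD mulmxDl -!/(ratmx _) ratmxM mulmxA.
rewrite (@col_mxA _ _ _ _ _ R (ratmx x *m R) (ratmx X *m R1)); exact: has_left_indices_cast hX.
Qed.

Lemma complementary_poly_rows m n q x (R : 'M[K]_(m, n)) (D : 'M[K]_(q, n)) :
    row_free D -> (D <= kermx R^T)%MS -> (q + (\rank R + x) = n)%N ->
  exists W : 'M[{poly F}]_(x, n),
    [/\ row_free (ratmx W), (R :&: ratmx W)%MS = 0,
        \rank (col_mx R (ratmx W)) = (\rank R + x)%N
      & (D :=: kermx (col_mx R (ratmx W))^T)%MS].
Proof.
move=> fD sDR szD; have [C rC CP] := complementary_rows fD sDR szD.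
have [C1 eqC] : exists C1 : 'M_(x, n), (C1 :=: C)%MS.
  by rewrite -rC; exists (row_base C); apply: eq_row_base.
have [a a0 [W aW]] := clear_denominators C1.
exists W; apply: CP; rewrite -aW; apply: eqmx_trans eqC.
by apply: eqmx_scale; rewrite tofrac_eq0.
Qed.

End Completion.

(** * The conditions in terms of lists of natural numbers *)

Section Translation.
Implicit Types (c d u v s : seq nat).

Lemma size_zseq s : size (zseq s) = size s.
Proof. exact: size_map. Qed.

Lemma nth_zseq s i : (zseq s)`_i = (nth 0%N s i)%:Z.
Proof.
have [lt|ge] := ltnP i (size s); first by rewrite (nth_map 0%N).
by rewrite !nth_default // size_zseq.
Qed.

Lemma sum_zseq s n : (n <= size s)%N ->
  \sum_(0 <= i < n) (zseq s)`_i = (sumn s)%:Z - (sumn (drop n s))%:Z.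
Proof.
move=> le; rewrite -{2}(cat_take_drop n s) sumn_cat PoszD addrK.
rewrite -[take n s]drop0 sumn_drop size_take_min (minn_idPl le) !big_mkord.
rewrite (big_morph Posz PoszD (erefl _)); apply: eq_bigr => i _.
by rewrite nth_zseq nth_take.
Qed.

Lemma ext_le0 (a : seq int) (i : int) : i <= 0 -> ext a i = +oo%E.
Proof. by rewrite /ext => le; rewrite (le_lt_trans le). Qed.

Lemma ext_nat s n : ext (zseq s) n.+1%:Z =
  if (n < size s)%N then ((nth 0%N s n)%:Z)%:E%E else -oo%E.
Proof.
by rewrite /ext /= lez_nat size_zseq; case: ifP => // _; rewrite subn1 /= nth_zseq.
Qed.

Lemma ext_lt_overtakes u v j (i : int) : (0 < j)%N ->
  (ext (zseq u) (i - j%:Z + 1) < ext (zseq v) i)%E <->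
  exists2 n : nat, i = n%:Z & overtakes u v j n.
Proof.
move=> j_gt0; have nonpos k : k <= 0 -> (ext (zseq u) (k - j%:Z + 1) < ext (zseq v) k)%E = false.
  by move=> le; rewrite !ext_le0 //; lia.
case: i => [[|n]|n].
- rewrite nonpos //; split=> // -[k [<-]]; by case/and4P.
- have [lt_nj|le_jn] := ltnP n.+1 j.
    rewrite (@ext_le0 _ (_ - _ + 1)); last by lia.
    split; first by rewrite ext_nat; case: ifP.
    by case=> k [<-] /and4P[]; rewrite leqNgt lt_nj.
  have -> : n.+1%:Z - j%:Z + 1 = (n.+1 - j).+1%:Z by lia.
  rewrite !ext_nat; split.
    move=> lt; exists n.+1 => //; rewrite /overtakes le_jn /=; move: lt.
    by case: (ltnP n) => //= _; case: ltnP => //= _; rewrite ?lte_fin.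
  case=> k [<-] /and4P[_ _ lt_n gap]; rewrite lt_n; case/orP: gap.
    by rewrite leqNgt => /negPf->; rewrite ltNyr.
  by case: ifP => _; rewrite ?ltNyr ?lte_fin.
by rewrite nonpos //; split=> // -[].
Qed.

Lemma hindex_overtake u v j h : (0 < j)%N ->
  hindex (zseq u) (zseq v) j h <-> first_overtake u v j h.
Proof.
move=> j_gt0; split=> [[/(ext_lt_overtakes _ _ _ j_gt0)[n [<-] over_n] min_h]|[over_h min_h]].
  split=> // i over_i; rewrite -lez_nat; apply: min_h.
  by apply/(ext_lt_overtakes _ _ _ j_gt0); exists i.
split; first by apply/(ext_lt_overtakes _ _ _ j_gt0); exists h.
by move=> i /(ext_lt_overtakes _ _ _ j_gt0)[n -> /min_h].
Qed.

Lemma hindex0 u v h : hindex (zseq u) (zseq v) 0 h -> h = 0%N.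
Proof.
case=> _ /(_ 0); rewrite lez_nat leqn0 => H; apply/eqP/H.
rewrite subr0 add0r [ext (zseq v) 0]ext_le0 // (ext_nat u 0).
by case: ifP; rewrite ?ltry.
Qed.

(** For t = 0 the equality of sums in [gen_major] is not automatic; there it comes
    from [completable_eq]. *)
Lemma gen_major_completable u v t :
    size v = (size u + t)%N ->
  let diff : int := (sumn v)%:Z - (sumn u)%:Z in
  0 <= diff /\ gen_major (zseq v) (zseq u) (head_seq diff t) <-> completable u v.
Proof.
move=> szv diff; rewrite /gen_major !size_zseq size_mkseq.
have le_sum : (0 <= diff) = (sumn u <= sumn v)%N by rewrite subr_ge0 lez_nat.
have majo_sum j h : (1 <= j <= t)%N -> first_overtake u v j h ->
    (\sum_(0 <= i < h) (zseq v)`_i - \sum_(0 <= i < h - j) (zseq u)`_i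
      <= \sum_(0 <= i < j) (head_seq diff t)`_i)
    = (sumn (drop (h - j) u) <= sumn (drop h v))%N.
  move=> /andP[j_gt0 le_jt] [/and4P[le_jh _ le_h _] min_h].
  have : (h <= size u + j)%N.
    by apply: min_h; rewrite /overtakes addnK leqnn szv /= andbT; lia.
  move=> le_hu; rewrite head_seq_sum ?j_gt0 // !sum_zseq //; last by lia.
  by rewrite /diff -lez_nat; apply/idP/idP; lia.
split=> [[diff_ge0 [tail majo _]]|uv].
  rewrite le_sum in diff_ge0; split=> // [i lt_i|j h].
    have := tail i.+1; rewrite szv addKn lt_i addSn !ext_nat lt_i => /(_ isT).
    by rewrite szv ltn_add2r lt_i lee_fin lez_nat.
  rewrite szv addKn => le_j over_h; rewrite -majo_sum //; apply: majo => //.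
  by apply/hindex_overtake => //; case/andP: le_j.
have [le tail majo] := uv; rewrite le_sum; split=> //; split.
- case=> // i /= lt_i; rewrite addSn !ext_nat lt_i szv ltn_add2r lt_i lee_fin lez_nat.
  by have := tail i lt_i; rewrite szv addKn.
- move=> j h le_j /hindex_overtake over_h; have {}over_h := over_h (proj1 (andP le_j)).
  by rewrite majo_sum // majo // szv addKn.
rewrite -szv !sum_zseq // !drop_size !subr0.
case: t szv {majo_sum} => [|t] szv.
  rewrite (completable_eq _ uv); last by rewrite szv addn0.
  by rewrite big_geq // addr0.
by rewrite head_seq_sum ?leqnn // /diff addrCA subrr addr0.
Qed.

Lemma ext_tail c d x h : (x <= h)%N -> size c = (size d + x)%N ->
  (forall i : nat, (h - x + 1 <= i <= size d)%N ->
     ext (zseq d) i%:Z = ext (zseq c) (i + x)%N%:Z) <->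
  drop (h - x) d = drop h c.
Proof.
move=> le_xh szc; split=> [H|e i]; last first.
  case: i => [|i]; first by rewrite addn1.
  rewrite addn1 => /andP[lt le]; rewrite addSn !ext_nat le szc ltn_add2r le.
  have := congr1 (nth 0%N ^~ (i - (h - x))%N) e; rewrite /= !nth_drop.
  have -> : (h - x + (i - (h - x)) = i)%N by lia.
  have -> : (h + (i - (h - x)) = i + x)%N by lia.
  by move=> ->.
apply: (@eq_from_nth _ 0%N) => [|i]; rewrite !size_drop ?szc; first by lia.
rewrite !nth_drop => lt_i; have lt : (h - x + i < size d)%N by lia.
have := H (h - x + i).+1; rewrite addn1 ltnS leq_addr lt => /(_ isT).
rewrite addSn !ext_nat lt szc ltn_add2r lt => -[->].
by congr (nth _ _ _); lia.
Qed.

End Translation.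

(** * Existence of completions *)

Section Main.
Variable F : fieldType.
Local Notation K := (ratfun F).

Lemma eqmx_col_mxA (L : fieldType) m1 m2 m3 n
    (A : 'M[L]_(m1, n)) (B : 'M_(m2, n)) (C : 'M_(m3, n)) :
  (col_mx (col_mx A B) C :=: col_mx A (col_mx B C))%MS.
Proof. by rewrite col_mxA; apply: eqmx_sym; apply: eqmx_cast. Qed.

Lemma sub_kermx_pad (L : fieldType) m z n (R : 'M[L]_(m, n)) (W : 'M_(z, n)) (y : 'rV_m) :
  (y <= kermx R)%MS = (row_mx y 0 <= kermx (col_mx R W))%MS.
Proof. by rewrite !sub_kermx mul_row_col mul0mx addr0. Qed.

Lemma hindex_ge c d x h : hindex (zseq d) (zseq c) x h -> (x <= h)%N.
Proof.
case: x => // x /hindex_overtake[] // over_h _.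
by case/and4P: over_h.
Qed.

Lemma overtakes_gap c d x h i j : sorted geq c -> sorted geq d ->
    overtakes d c x h -> (h - x <= i < size d)%N -> (j < h)%N ->
  (nth 0%N d i < nth 0%N c j)%N.
Proof.
move=> sc sd /and4P[_ h_gt0 _ gap] /andP[le_i lt_i] lt_j.
case/orP: gap => [le|lt]; first by lia.
apply: (@leq_ltn_trans (nth 0%N d (h - x))); first exact: sorted_geq_nth.
by apply: leq_trans lt _; apply: sorted_geq_nth => //; lia.
Qed.

(** The right kernel of the completed matrix lies in that of R; its left kernel
    restricts to that of R on the vectors whose last z coordinates vanish. *)
Lemma completion_necessary m n z x t h (R : 'M[K]_(m, n)) (W : 'M_(z, n)) c u d v :
    sorted geq c -> sorted geq u -> sorted geq d -> sorted geq v ->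
    size c = (size d + x)%N -> size v = (size u + t)%N ->
    hindex (zseq d) (zseq c) x h ->
    has_left_indices R^T c -> has_left_indices R u ->
    has_left_indices (col_mx R W)^T d -> has_left_indices (col_mx R W) v ->
  drop (h - x) d = drop h c /\ completable u v.
Proof.
move=> sc su sd sv szc szv hx [C [mC eqC dC]] [Y [mY eqY dY]] [D [mD eqD dD]] [Y' [mY' eqY' dY']].
split.
  apply: (subspace_tail sc sd mC mD dC dD _ szc (hindex_ge hx)).
    rewrite eqC sub_kermx_tr.
    have : (col_mx R W <= kermx (ratmx D)^T)%MS by rewrite sub_kermx_tr eqD.
    by rewrite col_mx_sub => /andP[].
  case: x hx {szc} => [/hindex0 -> //|x /hindex_overtake[] // over_h _ i j].
  exact: overtakes_gap sc sd over_h.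
have restr (y : 'rV_m) : (y <= ratmx Y)%MS = (row_mx y (0 : 'rV_z) <= ratmx Y')%MS.
  by rewrite eqY eqY' (sub_kermx_pad R W).
have tail a h' := @restriction_tail F m z u v Y Y' mY mY' dY dY' restr a h' su.
split.
- by have := tail 0%N 0%N; rewrite !drop0; apply.
- move=> i lt_i; apply: (restriction_nth mY mY' dY dY' restr su sv _ lt_i).
  by rewrite szv leq_addr.
move=> j h' /andP[j_gt0 _] [over_h _]; apply: tail => i l.
exact: overtakes_gap sv su over_h.
Qed.

(** The dependent rows X R come first: they enlarge the left kernel, and the
    independent rows W, added next, leave it unchanged. *)
Lemma completion_sufficient m n x t h (R : 'M[K]_(m, n)) c u d v :
    (0 < \rank R)%N ->
    sorted geq c -> sorted geq u -> sorted geq v ->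
    size c = (size d + x)%N -> size v = (size u + t)%N ->
    hindex (zseq d) (zseq c) x h ->
    has_left_indices R^T c -> has_left_indices R u ->
    drop (h - x) d = drop h c -> completable u v ->
  exists (X : 'M[{poly F}]_(t, m)) (W : 'M[{poly F}]_(x, n)),
    let R' := col_mx R (col_mx (ratmx X *m R) (ratmx W)) in
    [/\ \rank R' = (\rank R + x)%N, has_left_indices R'^T d & has_left_indices R' v].
Proof.
move=> rR sc su sv szc szv hx hC hu tail_d uv.
have [X hX] := add_rows rR su sv szv uv hu; set R1 := col_mx R _ in hX.
have [C [mC eqC dC]] := hC.
have head_d i : (i + x < h)%N -> (0 < x)%N && (nth 0%N c (i + x).-1 <= nth 0%N d i)%N.
  case: x hx szc {tail_d} => [/hindex0 -> //|x /hindex_overtake[] // over_h min_h] szc lt_i.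
  rewrite /= leqNgt; apply/negP => lt; have : (h <= i + x.+1)%N.
    apply: min_h; rewrite /overtakes leq_addl addn_gt0 orbT addnK lt orbT andbT /=.
    by case/and4P: over_h => _ _ le_h _; exact: leq_trans (ltnW lt_i) le_h.
  by rewrite leqNgt lt_i.
have [D [mD dD sDC]] := subspace_exists sc mC dC szc (hindex_ge hx) head_d tail_d.
have eqR1 : (R1 :=: R)%MS.
  apply/eqmxP; rewrite col_mx_sub submx_refl submxMl /=.
  by have := submx_refl R1; rewrite col_mx_sub => /andP[].
have [|||W [fW RW rW eqDW]] := @complementary_poly_rows F _ n (size d) x R1 (ratmx D).
- exact: minimal_row_free.
- rewrite sub_kermx_tr eqR1 sub_kermx_tr; apply: submx_trans sDC _; by rewrite eqC.
- have := has_left_indices_size hC; rewrite eqR1 mxrank_tr szc.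
  by have := rank_leq_col R; lia.
exists X, W => R'; have eqR' : (col_mx R1 (ratmx W) :=: R')%MS := eqmx_col_mxA _ _ _.
split; first by rewrite -eqR' rW eqR1.
  by apply: has_right_indices_eqmx eqR' _; exists D.
rewrite /R' (@col_mxA _ _ _ _ _ R (ratmx X *m R) (ratmx W)).
exact/has_left_indices_cast/has_left_indices_independent.
Qed.

End Main.

Theorem theorem3p14 (F : fieldType) (m n r z x : nat) (c u d v : seq nat)
    (h : nat)
    (r_ge1 : (1 <= r)%N)
    (le_x : (x <= minn z (n - r))%N)
    (size_d : size d = (n - r - x)%N) (dec_d : sorted geq d)
    (size_v : size v = (m + z - r - x)%N) (dec_v : sorted geq v)
    (h_def : hindex (zseq d) (zseq c) x h) :
  let diff : int := (\sum_(i <- v) i)%N%:Z - (\sum_(i <- u) i)%N%:Z in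
  let conditions : Prop :=
    [/\ forall i : nat, (h - x + 1 <= i <= n - r - x)%N ->
          ext (zseq d) i%:Z = ext (zseq c) (i + x)%N%:Z,
        0 <= diff
      & gen_major (zseq v) (zseq u) (head_seq diff (z - x))] in
  (forall R : 'M[ratfun F]_(m, n),
     \rank R = r -> column_minimal_indices R c -> row_minimal_indices R u ->
     (exists W : 'M[ratfun F]_(z, n),
        [/\ \rank (col_mx R W) = (r + x)%N,
            column_minimal_indices (col_mx R W) d
          & row_minimal_indices (col_mx R W) v])
     <-> conditions) /\
  (forall R : 'M[{poly F}]_(m, n),
     \rank (ratmx R) = r ->
     column_minimal_indices (ratmx R) c -> row_minimal_indices (ratmx R) u ->
     (exists W : 'M[{poly F}]_(z, n),
        [/\ \rank (ratmx (col_mx R W)) = (r + x)%N,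
            column_minimal_indices (ratmx (col_mx R W)) d
          & row_minimal_indices (ratmx (col_mx R W)) v])
     <-> conditions).
Proof.
move=> diff conditions.
move: le_x; rewrite leq_min => /andP[le_xz le_xr].
have [t zE] : exists t, z = (t + x)%N by exists (z - x)%N; rewrite subnK.
subst z.
have sizes (R : 'M[ratfun F]_(m, n)) : \rank R = r ->
    column_minimal_indices R c -> row_minimal_indices R u ->
  size c = (size d + x)%N /\ size v = (size u + t)%N.
  move=> rR /column_minimal_indicesP[_ /has_left_indices_size szc].
  move=> /row_minimal_indicesP[_ /has_left_indices_size szu].
  rewrite szc szu mxrank_tr rR size_d size_v; have := rank_leq_row R; rewrite rR.
  by split; lia.
have condE : size c = (size d + x)%N -> size v = (size u + t)%N ->
    conditions <-> drop (h - x) d = drop h c /\ completable u v.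
  move=> szc szv; have tailE := ext_tail (hindex_ge h_def) szc.
  have majoE := gen_major_completable szv; rewrite !sumnE in majoE.
  rewrite /conditions -size_d addnK; split.
    by case=> /tailE cd ge0 majo; split=> //; apply/majoE.
  by case=> /tailE cd /majoE[ge0 majo]; split.
have necessary (R : 'M[ratfun F]_(m, n)) (W : 'M[ratfun F]_(t + x, n)) : \rank R = r ->
    column_minimal_indices R c -> row_minimal_indices R u ->
    column_minimal_indices (col_mx R W) d -> row_minimal_indices (col_mx R W) v ->
  conditions.
  move=> rR cR uR; have [szc szv] := sizes R rR cR uR.
  move/column_minimal_indicesP: cR => [sc hC]; move/row_minimal_indicesP: uR => [su hu].
  move=> /column_minimal_indicesP[_ hd] /row_minimal_indicesP[_ hv].
  apply/(condE szc szv).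
  exact: completion_necessary sc su dec_d dec_v szc szv h_def hC hu hd hv.
have sufficient (R : 'M[ratfun F]_(m, n)) : \rank R = r ->
    column_minimal_indices R c -> row_minimal_indices R u -> conditions ->
  exists (X : 'M[{poly F}]_(t, m)) (W : 'M[{poly F}]_(x, n)),
    let R' := col_mx R (col_mx (ratmx X *m R) (ratmx W)) in
    [/\ \rank R' = (r + x)%N, column_minimal_indices R' d & row_minimal_indices R' v].
  move=> rR cR uR; have [szc szv] := sizes R rR cR uR.
  move/column_minimal_indicesP: cR => [sc hC]; move/row_minimal_indicesP: uR => [su hu].
  move=> /(condE szc szv)[tail_d uv]; have rR0 : (0 < \rank R)%N by rewrite rR.
  have [X [W [rW hd hv]]] := completion_sufficient rR0 sc su dec_v szc szv h_def hC hu tail_d uv.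
  exists X, W => R'; rewrite rW rR; split=> //; first exact/column_minimal_indicesP.
  exact/row_minimal_indicesP.
split=> R rR cR uR; split.
- by case=> W [_ cW uW]; apply: necessary rR cR uR cW uW.
- move=> /(sufficient R rR cR uR)[X [W [rW cW uW]]].
  by exists (col_mx (ratmx X *m R) (ratmx W)).
- case=> W []; rewrite /ratmx map_col_mx -!/(ratmx _) => _ cW uW.
  exact: necessary rR cR uR cW uW.
move=> /(sufficient (ratmx R) rR cR uR)[X [W]]; rewrite -ratmxM /ratmx -!map_col_mx -!/(ratmx _).
by exists (col_mx (X *m R) W).
Qed.
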